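(* Let $\mathcal{H}$ be a real Hilbert space and let $f:\mathcal{H}\to\mathbb{R}$ be a convex function of class $\mathcal{C}^1$ such that $S:=\operatorname{argmin}_{\mathcal{H}} f\neq\emptyset$ and $\nabla f$ is Lipschitz continuous on every bounded subset of $\mathcal{H}$. Let $s_0>0$, assume that $\alpha>1$, and let $y:[s_0,+\infty[\to\mathcal{H}$ be a solution trajectory of $$\ddot y(s)+\frac{\alpha}{s}\dot y(s)+\frac{s}{\alpha+1}\frac{d}{ds}\left(\nabla f(y(s))\right)+\nabla f(y(s))=0.$$ Then the following statements are true: (i) $\int_{s_0}^{+\infty}s\,\|\dot y(s)\|^2ds<+\infty$; (ii) $\int_{s_0}^{+\infty}s\left(f(y(s))-\inf_{\mathcal{H}}f\right)ds<+\infty$; (iii) $\int_{s_0}^{+\infty}s^3\|\nabla f(y(s))\|^2ds<+\infty$; (iv) $f(y(s))-\inf_{\mathcal{H}}f=o\left(\frac1{s^2}\right)$ as $s\to+\infty$; (v) $y(s)$ converges weakly as $s\to+\infty$, and its limit belongs to $S$. If $\alpha>2$, then (vi) $\|\dot y(s)\|=o\left(\frac1s\right)$ as $s\to+\infty$; (vii) $\|\nabla f(y(s))\|=o\left(\frac1{s^2}\right)$ as $s\to+\infty$.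
   Context: A solution trajectory is a function $y$ of class $\mathcal{C}^1$ on $[s_0,+\infty[$ such that $\dot y$ is locally absolutely continuous (then $s\mapsto\nabla f(y(s))$ is locally Lipschitz, hence also locally absolutely continuous) and the equation holds for almost every $s\ge s_0$. *)

(* Defs.v *)
From HB Require Import structures.
From mathcomp Require Export all_boot all_order all_algebra.
From mathcomp Require Export sesquilinear.
From mathcomp Require Export all_classical all_reals all_analysis.

Set Implicit Arguments.
Unset Strict Implicit.
Unset Printing Implicit Defensive.

Export Order.TTheory GRing.Theory Num.Theory.
Export numFieldNormedType.Exports.

#[global] Open Scope classical_set_scope.
#[global] Open Scope ring_scope.

(* Lets the Landau notations of the library be used at infinity. *)
Canonical pinfty_filter_on (R : numFieldType) : filter_on R :=
  FilterType (pinfty_nbhs R) _.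

(* A real Hilbert space is a complete normed module [H] over [R] together with
   a symmetric positive definite bilinear form inducing the norm of [H]. *)
Definition induces_norm (R : realType) (H : completeNormedModType R)
    (ip : {dot H for idfun}) : Prop :=
  forall x : H, ip x x = `|x| ^+ 2.

(* Fréchet differentiable everywhere, with a differential that is continuous
   for the operator norm. *)
Definition class_C1 (R : realType) (H : completeNormedModType R)
    (f : H -> R) : Prop :=
  (forall x, differentiable f x) /\
  (forall (x : H) (e : R), 0 < e ->
     \forall z \near x, forall h : H, `|'d f z h - 'd f x h| <= e * `|h|).

(* The Riesz representative of the differential; junk where [f] is not
   differentiable. *)
Definition gradient (R : realType) (H : completeNormedModType R)
    (ip : {dot H for idfun}) (f : H -> R) (x : H) : H :=
  get [set g : H | forall h : H, 'd f x h = ip g h].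

Definition argmin (R : realType) (H : completeNormedModType R) (f : H -> R) :
    set H :=
  [set x | forall z, f x <= f z].

(* Weak convergence of the filter [F], tested on the whole continuous dual. *)
Definition weak_cvg (R : realType) (H : completeNormedModType R)
    (F : set_system H) (l : H) : Prop :=
  forall phi : {linear H -> R^o}, continuous phi -> phi @ F --> phi l.

(* Derivative relative to [A]: two-sided in the interior of an interval,
   one-sided at an endpoint belonging to it. *)
Definition derivable_within (R : realType) (H : completeNormedModType R)
    (A : set R) (y : R -> H) (s : R) : Prop :=
  cvg ((fun t : R => (t - s)^-1 *: (y t - y s)) @ within A s^').

Definition derive_within (R : realType) (H : completeNormedModType R)
    (A : set R) (y : R -> H) (s : R) : H :=
  lim ((fun t : R => (t - s)^-1 *: (y t - y s)) @ within A s^').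

Definition class_C1_within (R : realType) (H : completeNormedModType R)
    (A : set R) (y : R -> H) : Prop :=
  (forall s, A s -> derivable_within A y s) /\
  {within A, continuous (derive_within A y)}.

Definition abs_continuous (R : realType) (H : completeNormedModType R)
    (a b : R) (g : R -> H) : Prop :=
  forall e : R, 0 < e -> exists2 d : R, 0 < d &
    forall (n : nat) (u v : 'I_n -> R),
      (forall i, a <= u i /\ u i <= v i /\ v i <= b) ->
      trivIset setT (fun i => `]u i, v i[%classic) ->
      \sum_(i < n) (v i - u i) < d ->
      \sum_(i < n) `|g (v i) - g (u i)| < e.

Definition locally_abs_continuous (R : realType) (H : completeNormedModType R)
    (s0 : R) (g : R -> H) : Prop :=
  forall a b : R, s0 <= a -> abs_continuous a b g.

(* For the equation to hold at [s] both derivatives occurring in it must exist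
   there.  Values of [y] to the left of [s0] play no role. *)
Definition solution_trajectory (R : realType) (H : completeNormedModType R)
    (ip : {dot H for idfun}) (f : H -> R) (alpha s0 : R) (y : R -> H) : Prop :=
  let I : set R := `[s0, +oo[%classic in
  let dy := derive_within I y in
  let gy := gradient ip f \o y in
  [/\ class_C1_within I y,
      locally_abs_continuous s0 dy &
      {ae (@lebesgue_measure R), forall s : R, s0 <= s ->
        [/\ derivable_within I dy s,
            derivable_within I gy s &
            derive_within I dy s + (alpha / s) *: dy s
            + (s / (alpha + 1)) *: derive_within I gy s + gy s = 0]}].

(* Main.v *)
Require Import Defs.
From mathcomp Require Import ring lra.

Set Implicit Arguments.
Unset Strict Implicit.
Unset Printing Implicit Defensive.

(** Why the theorem holds.

    Write G(s) for the gradient of f at y(s).  Multiplied by s^alpha, the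
    equation is an exact derivative: almost everywhere,
      d/ds [ s^alpha y'(s) + s^(alpha + 1) G(s) / (alpha + 1) ] = 0.
    The bracket is locally absolutely continuous, hence equal to a constant
    vector C, and the trajectory solves a first-order equation
    ([ode_first_order]):
      y'(s) = - s G(s) / (alpha + 1) + s^(- alpha) C.
    Up to a change of time this is the gradient flow of f with a perturbation,
    which is integrable since alpha > 1.  Let tail(s) be the integral of
    r^(- alpha) over r >= s.  The shifted curve y + tail C absorbs the
    perturbation, its velocity being exactly - s G(s) / (alpha + 1).

    Let z be a minimizer, gap = f(y) - f(z) and beta = 1 / (alpha + 1).  For
    0 < theta < beta the energy
      |y + tail C - z|^2 + theta s^2 gap + kappa tail^2
    has a derivative bounded above by
      - 2 (beta - theta) s gap - (theta beta / 2) s^3 |G|^2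
    ([denergy_le]): convexity bounds the inner product of G with y - z from
    below by gap, and kappa is chosen so that Young's inequality absorbs the
    terms in which C occurs.  The energy is nonnegative, so s gap and s^3 |G|^2
    are integrable, and by the first-order equation so is s |y'|^2.  The energy
    converges for two values of theta, so s^2 gap and |y + tail C - z| both
    converge ([sq_gap_cvg], [shifted_dist_cvg]); as s gap = (s^2 gap) / s is
    integrable, the limit of s^2 gap is 0.

    Weak convergence is Opial's lemma ([opial]) for the shifted curve: its
    distance to each minimizer converges, and its weak limits along ultrafilters
    are minimizers by the gradient inequality.  Such weak limits exist because
    bounded scalar functions converge along ultrafilters and the limit
    functional is represented by a vector ([riesz_representation],
    [ultra_weak_limit]).

    For the decay of the velocity, add to s^2 |y'|^2 the function 2 s^2 gap and
    a multiple of the energy.  In the derivative, which exists almost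
    everywhere, the second-order equation produces the inner product of G' and
    y', which is nonnegative by monotonicity of the gradient; the sum is
    nonincreasing ([total_energy_nonincreasing]), so s^2 |y'|^2 converges, and
    its limit is 0 because s |y'|^2 is integrable.  The first-order equation
    then gives the decay of the gradient.

    Two facts of real analysis support this: a locally absolutely continuous
    function whose derivative is nonpositive almost everywhere is nonincreasing
    ([ac_ae_nonincreasing]), and a function bounded below whose derivative is at
    most - g, with g nonnegative and continuous, forces g to be integrable on
    the half-line ([lyapunov_integral_lt_pinfty]). *)

(** * Derivatives of functions of a real variable *)

Lemma is_derive1_cvgP (R : realType) (V : normedModType R) (g : R -> V) (c : R) (d : V) :
  is_derive c 1 g d <-> h^-1 *: (g (h + c) - g c) @[h --> 0^'] --> d.
Proof.
rewrite (_ : (fun h => h^-1 *: (g (h + c) - g c)) =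
             (fun h : R => h^-1 *: (g (h *: 1 + c) - g c))).
  split; first by move=> [+ <-].
  by move=> gd; split; [apply/cvg_ex; exists d|exact/cvg_lim].
by apply/funext => h; rewrite [_ *: 1]mulr1.
Qed.

(** The division-free form of the derivative: it covers increments on both
    sides of the point at once and leaves no quotient to rewrite. *)
Lemma is_derive1P (R : realType) (V : normedModType R) (g : R -> V) (c : R) (d : V) :
  is_derive c 1 g d <->
  forall e, 0 < e -> exists2 r, 0 < r & forall t, `|t - c| < r ->
    `|g t - g c - (t - c) *: d| <= e * `|t - c|.
Proof.
have dq h t : t - c = h -> h != 0 ->
    `|g t - g c - (t - c) *: d| = `|h| * `|d - h^-1 *: (g (h + c) - g c)|.
  move=> <- h0; rewrite -normrZ scalerBr scalerA divff// scale1r distrC.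
  by rewrite subrK.
split=> [/is_derive1_cvgP/cvgrPdist_le gd e e0|gd].
  have /= [r r0 gr] := gd e e0.
  exists r => // t tr; have [tc|tc] := eqVneq (t - c) 0.
    by rewrite tc normr0 mulr0 scale0r subr0 (subr0_eq tc) subrr normr0.
  rewrite (dq (t - c))// mulrC ler_wpM2r//; apply: gr => //=.
  by rewrite sub0r normrN.
apply/is_derive1_cvgP/cvgrPdist_le => e e0; have [r r0 gr] := gd e e0.
exists r => //= h; rewrite /= sub0r normrN => hr h0.
have : `|g (h + c) - g c - (h + c - c) *: d| <= e * `|h + c - c|.
  by apply: gr; rewrite addrK.
by rewrite (dq h) ?addrK// mulrC ler_pM2r// normr_gt0.
Qed.

Lemma is_derive_continuous (R : realType) (W : normedModType R) (u : R -> W) (s : R) (d : W) :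
  is_derive s 1 u d -> {for s, continuous u}.
Proof. by move=> [/derivable1_diffP/differentiable_continuous]. Qed.

Section pointwise_derivatives.
Context (R : realType).
Implicit Types (g h : R -> R) (s dg dh k : R).

Lemma is_derive_add g h s dg dh : is_derive s 1 g dg -> is_derive s 1 h dh ->
  is_derive s 1 (fun x => g x + h x) (dg + dh).
Proof. exact: is_deriveD. Qed.

Lemma is_derive_mul g h s dg dh : is_derive s 1 g dg -> is_derive s 1 h dh ->
  is_derive s 1 (fun x => g x * h x) (dg * h s + g s * dh).
Proof.
move=> dg' dh'; have := is_deriveM dg' dh'.
by move/is_derive_eq; apply; rewrite addrC [X in X + _]mulrC.
Qed.

Lemma is_derive_mulC g k s dg : is_derive s 1 g dg ->
  is_derive s 1 (fun x => k * g x) (k * dg).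
Proof. by move=> dg'; exact: (is_deriveZ k dg'). Qed.

Lemma is_derive_inv g s dg : g s != 0 -> is_derive s 1 g dg ->
  is_derive s 1 (fun x => (g x)^-1) (- dg / g s ^+ 2).
Proof.
move=> gs0 dg'; have := is_deriveV gs0 dg'.
by move/is_derive_eq; apply; rewrite [LHS]mulrC mulrN mulNr.
Qed.

Lemma is_derive_sqr g s dg : is_derive s 1 g dg ->
  is_derive s 1 (fun x => g x ^+ 2) (2 * g s * dg).
Proof.
move=> dg'; have := is_derive_mul dg' dg'.
by move/is_derive_eq; apply; ring.
Qed.

End pointwise_derivatives.

Lemma derive_le0_le (R : realType) (V dV : R -> R) (a b : R) : a <= b ->
  {within `[a, b], continuous V} ->
  (forall s, a < s -> s < b -> is_derive s 1 V (dV s)) ->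
  (forall s, a <= s -> s <= b -> dV s <= 0) ->
  V b <= V a.
Proof.
move=> ab cV derV dV0.
have [|//|c] := @MVT_segment R V dV a b ab.
  by move=> x; rewrite in_itv/= => /andP[? ?]; exact: derV.
rewrite in_itv/= => /andP[ac cb] E.
by rewrite -subr_le0 E mulr_le0_ge0 ?subr_ge0// dV0.
Qed.

Lemma continuous_itv_bounded (R : realType) (V : normedModType R) (h : R -> V) (a b : R) :
  (forall s, a <= s <= b -> {for s, continuous h}) ->
  exists2 K, 0 < K & forall s, a <= s <= b -> `|h s| <= K.
Proof.
move=> ch.
have [ab|ba] := leP a b; last first.
  by exists 1 => // s /andP[as_ sb]; have := le_trans as_ sb; rewrite leNgt ba.
have [|c _ cM] := @EVT_max R (fun s => `|h s|) a b ab.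
  apply: continuous_in_subspaceT => x; rewrite inE/= in_itv/= => xab.
  by apply: cvg_norm; exact: ch.
exists (`|h c| + 1); first by rewrite ltr_wpDl.
by move=> s sab; rewrite (le_trans (cM s _))// lerDl.
Qed.

(** * Monotonicity of absolutely continuous functions *)

(** Induction along a segment: the local step at the supremum of the points
    reached shows that the supremum is reached, and goes beyond it unless it is
    [b].  The local step is stated for intervals around the tag [c], as in
    Cousin's lemma, so that a gauge on both sides of [c] provides it. *)
Lemma real_induction (R : realType) (Q : R -> Prop) (a b : R) : a <= b -> Q a ->
  (forall c, a <= c <= b -> exists2 r, 0 < r & forall x w,
     a <= x -> x <= c -> c <= w -> w <= b -> c - r < x -> w < c + r ->
     Q x -> Q w) ->
  Q b.
Proof.
move=> ab Qa step; pose A := [set x | a <= x <= b /\ Q x].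
have Aa : A a by rewrite /A/= lexx ab.
have Ab : ubound A b by move=> x [/andP[]].
have supA : has_sup A by split; [exists a|exists b].
pose c := sup A.
have acb : a <= c <= b.
  by rewrite ub_le_sup/= ?ge_sup//; [exists a|exists b].
have [r r0 cr] := step _ acb.
have /andP[ac cb] := acb.
have [x [/andP[ax xb] Qx] cx] := sup_adherent r0 supA.
have xc : x <= c by apply: ub_le_sup; [exists b|split => //; rewrite ax].
have Qmin : Q (Num.min b (c + r / 2)).
  apply: (cr x) => //.
  - by rewrite le_min cb lerDl divr_ge0// ltW.
  - by rewrite ge_min lexx.
  - by rewrite gt_min; apply/orP; right; lra.
have [bc|bc] := leP b (c + r / 2); first by move: Qmin; rewrite min_l.
have : c + r / 2 <= c.
  apply: ub_le_sup; first by exists b.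
  split; last by move: Qmin; rewrite min_r// ltW.
  by apply/andP; split; lra.
lra.
Qed.

Section absolute_continuity.
Context (R : realType).
Implicit Types (a b : R) (g : R -> R) (U : set R).

Lemma sum_disjoint_itv_le (n : nat) (u v : 'I_n -> R) U : open U ->
  (forall i, u i <= v i) -> (forall i, `]u i, v i[ `<=` U) ->
  trivIset setT (fun i => `]u i, v i[%classic) ->
  ((\sum_(i < n) (v i - u i))%:E <= lebesgue_measure U)%E.
Proof.
move=> oU uv uvU tuv.
rewrite -sumEFin (eq_bigr (fun i => lebesgue_measure `]u i, v i[%classic)).
  rewrite -(measure_bigsetU_ord lebesgue_measure xpredT _ tuv); last first.
    by move=> i; exact: measurable_itv.
  apply: le_measure; rewrite ?inE.
  - by apply: bigsetU_measurable => i _; exact: measurable_itv.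
  - exact: measurable_realfun.open_measurable.
  - elim/big_ind : _ => [|A B AU BU|i _]; [exact: sub0set| |exact: uvU].
    by rewrite subUset.
move=> i _; rewrite lebesgue_measure_itv/= lte_fin.
by have := uv i; rewrite le_eqVlt => /predU1P[->|->//]; rewrite ltxx subrr.
Qed.

Lemma null_open_cover (N : set R) (e : R) : 0 < e ->
  lebesgue_measure.-negligible N ->
  exists U, [/\ open U, N `<=` U & (lebesgue_measure U < e%:E)%E].
Proof.
move=> e0 [M [mM M0 NM]].
have [|U [oU MU UM]] := lebesgue_regularity_outer mM _ e0.
  exact: (eq_ind_r (fun x => x < +oo)%E (ltry 0) M0).
exists U; split => //; first exact: subset_trans MU.
have -> : lebesgue_measure U =
    (lebesgue_measure (U `\` M) + lebesgue_measure (U `&` M))%E.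
  by apply: measureDI => //; exact: measurable_realfun.open_measurable.
by rewrite setIC (setIidl MU) [X in (_ + X)%E](M0 : lebesgue_measure M = 0%E) adde0.
Qed.

(** A gauge argument.  Fix [e], cover the points
    where the derivative is missing or positive by an open set [U] of small
    measure, and move along the segment by small steps: around a good point [g]
    grows by at most [e] times the length of the step, and the steps around a
    bad point are recorded in a list of disjoint intervals contained in [U].
    Absolute continuity bounds the total variation of [g] over that list. *)
Lemma ac_ae_nonincreasing a b g : a <= b -> abs_continuous a b (g : R -> R^o) ->
  {ae (@lebesgue_measure R), forall s, a < s < b ->
     exists2 d, d <= 0 & is_derive s 1 (g : R -> R^o) d} ->
  g b <= g a.
Proof.
move=> ab acg aeg.
suff ge e : 0 < e -> g b - g a <= e * (b - a + 1).
  rewrite -subr_le0; apply/ler_addgt0Pr => e e0; rewrite add0r.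
  have ba : 0 < b - a + 1 by lra.
  by have := ge _ (divr_gt0 e0 ba); rewrite divfK// gt_eqF.
move=> e0; have [del del0 acdel] := acg e e0.
have nN : lebesgue_measure.-negligible (~` [set s | a < s < b ->
     exists2 d, d <= 0 & is_derive s 1 (g : R -> R^o) d] `|` [set a; b]).
  by apply: negligibleU => //; apply: negligibleU;
    apply/negligibleP => //; exact: lebesgue_measure_set1.
have [U [oU NU Udel]] := null_open_cover del0 nN.
(* The most recent interval is at the head of [s]. *)
pose Q x := exists s : seq (R * R), [/\
  forall p, p \in s -> [/\ a <= p.1, p.1 <= p.2, p.2 <= x & `]p.1, p.2[ `<=` U],
  pairwise (fun p q => q.2 <= p.1) s &
  g x - g a <= e * (x - a) + \sum_(p <- s) `|g p.2 - g p.1|].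
have [s [sU sdisj gs]] : Q b.
  apply: (real_induction ab).
    by exists [::]; split => //; rewrite big_nil !subrr mulr0 addr0.
  move=> c /andP[ac cb].
  have [Uc|nUc] := pselect (U c).
    have [r /= r0 rU] : nbhs c U by apply: open_nbhs_nbhs.
    exists r => // x w ax xc cw wb crx wcr [s [sP sdisj gs]].
    exists ((x, w) :: s); split.
    - move=> p; rewrite inE => /predU1P[->/=|/sP[? ? px ?]].
        split => //; first exact: le_trans cw.
        move=> z /=; rewrite in_itv/= => /andP[xz zw]; apply: rU => /=.
        by rewrite ltr_distl; apply/andP; split; lra.
      split => //; lra.
    - rewrite /= sdisj andbT; apply/allP => p /sP[? ? px ?] //.
    - rewrite big_cons/=; have := ler_norm (g w - g x).
      have : e * (x - a) <= e * (w - a) by rewrite ler_pM2l//; lra.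
      lra.
  have Nc : ~ (~` [set s | a < s < b ->
     exists2 d, d <= 0 & is_derive s 1 (g : R -> R^o) d] `|` [set a; b]) c.
    by move=> Nc; apply: nUc; exact: NU.
  have acb : a < c < b.
    rewrite !lt_neqAle ac cb !andbT; apply/andP; split; apply/eqP => E; apply: Nc; right.
      by left; rewrite /= E.
    by right; rewrite /= E.
  have [d d0] : exists2 d, d <= 0 & is_derive c 1 (g : R -> R^o) d.
    by apply: contrapT => nd; apply: Nc; left => /(_ acb).
  move=> /is_derive1P/(_ e e0)[r r0 gr].
  exists r => // x w ax xc cw wb crx wcr [s [sP sdisj gs]].
  exists s; split => //.
    by move=> p /sP[? ? px ?]; split => //; lra.
  have /gr : `|w - c| < r by rewrite ltr_distl; apply/andP; split; lra.
  rewrite [`|w - c|]ger0_norm ?subr_ge0// => /ler_normlW gw.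
  have /gr : `|x - c| < r by rewrite ltr_distl; apply/andP; split; lra.
  rewrite [`|x - c|]ler0_norm ?subr_le0// -normrN => /ler_normlW gx.
  have : (w - c) *: (d : R^o) <= 0 by rewrite mulr_ge0_le0// subr_ge0.
  have : 0 <= (x - c) *: (d : R^o) by rewrite mulr_le0// subr_le0.
  have : e * (w - a) = e * (x - a) + e * (w - c) + e * - (x - c) by ring.
  move: gw gx; lra.
pose u (i : 'I_(size s)) := (nth (0, 0) s i).1.
pose v (i : 'I_(size s)) := (nth (0, 0) s i).2.
have uvP i : [/\ a <= u i, u i <= v i, v i <= b & `]u i, v i[ `<=` U].
  by apply: sU; exact: mem_nth.
have tuv : trivIset setT (fun i => `]u i, v i[%classic).
  have ltd (i j : 'I_(size s)) : (i < j)%N -> v j <= u i.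
    by move=> ij; move/(pairwiseP (0, 0)): sdisj; apply => //; rewrite inE.
  move=> i j _ _ [z [/=]]; rewrite !in_itv/= => /andP[zi iz] /andP[zj jz].
  apply/val_inj; case: (ltngtP i j) => // /ltd ?; exfalso; lra.
have : \sum_(p <- s) `|g p.2 - g p.1| < e.
  rewrite (big_nth (0, 0)) big_mkord; apply: (acdel _ u v) => //.
  - by move=> i; have [] := uvP i.
  - rewrite -lte_fin (le_lt_trans _ Udel)//; apply: sum_disjoint_itv_le => // i;
      by have [] := uvP i.
lra.
Qed.

Lemma abs_continuous_dominated (H K : completeNormedModType R) a b (M : R)
    (g : R -> H) (p : R -> K) :
  abs_continuous a b p ->
  (forall u v, a <= u -> u <= v -> v <= b ->
     `|g v - g u| <= M * (`|p v - p u| + (v - u))) ->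
  abs_continuous a b g.
Proof.
move=> acp gM.
wlog M0 : M gM / 0 < M.
  move=> wl; apply: (wl (Num.max M 1)); last by rewrite lt_max ltr01 orbT.
  move=> u v au uv vb; apply: (le_trans (gM _ _ au uv vb)).
  by rewrite ler_wpM2r ?le_max ?lexx// addr_ge0// subr_ge0.
move=> e e0; have eM0 : 0 < e / M / 2 by rewrite !divr_gt0.
have [d d0 acd] := acp _ eM0.
exists (Num.min d (e / M / 2)); first by rewrite lt_min d0.
move=> n u v uvab tuv; rewrite lt_min => /andP[/(acd _ u v uvab tuv) sp su].
apply: (@le_lt_trans _ _ (M * (\sum_(i < n) `|p (v i) - p (u i)| + \sum_(i < n) (v i - u i)))).
  rewrite -big_split/= mulr_sumr; apply: ler_sum => i _.
  by have [? [? ?]] := uvab i; exact: gM.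
by rewrite -ltr_pdivlMl// mulrC; lra.
Qed.

End absolute_continuity.

Section dominated.
Context (R : realType) (H : completeNormedModType R) (p : R -> H) (a b : R).

(** A modulus that is stable under sums and products and transports absolute
    continuity from [p] to functions built from [p] and smooth functions. *)
Definition dominated (g : R -> R) := exists2 M, 0 <= M &
  forall s t, a <= s -> s <= t -> t <= b ->
    `|g t - g s| <= M * (`|p t - p s| + (t - s)).

Lemma dominated_abs_continuous g :
  abs_continuous a b p -> dominated g -> abs_continuous a b (g : R -> R^o).
Proof. by move=> acp [M _ gM]; exact: abs_continuous_dominated acp gM. Qed.

Lemma dominatedD g h :
  dominated g -> dominated h -> dominated (fun s => g s + h s).
Proof.
move=> [M M0 gM] [N N0 hN]; exists (M + N); first exact: addr_ge0.
move=> s t as_ st tb; rewrite opprD addrACA mulrDl.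
by rewrite (le_trans (ler_normD _ _))// lerD ?gM ?hN.
Qed.

Lemma dominatedM g h :
  (forall s, a <= s <= b -> {for s, continuous g}) ->
  (forall s, a <= s <= b -> {for s, continuous h}) ->
  dominated g -> dominated h -> dominated (fun s => g s * h s).
Proof.
move=> /(@continuous_itv_bounded _ R^o)[G G0 gG] /(@continuous_itv_bounded _ R^o)[K K0 hK].
move=> [M M0 gM] [N N0 hN].
exists (G * N + K * M); first by rewrite addr_ge0 ?mulr_ge0// ltW.
move=> s t as_ st tb.
have -> : g t * h t - g s * h s = g t * (h t - h s) + (g t - g s) * h s by ring.
rewrite (le_trans (ler_normD _ _))// !normrM mulrDl -!mulrA lerD//.
  by rewrite ler_pM// ?gG ?hN// (le_trans as_ st).
rewrite mulrC ler_pM// ?gM// hK// as_ (le_trans st)//.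
Qed.

Lemma dominated_derive (g dg : R -> R) :
  (forall s, a <= s <= b -> is_derive s 1 g (dg s)) ->
  (forall s, a <= s <= b -> {for s, continuous dg}) ->
  dominated g.
Proof.
move=> derg /(@continuous_itv_bounded _ R^o)[K K0 dgK]; exists K; first exact: ltW.
move=> s t as_ st tb; have [|x|c cst ->] := @MVT_segment R g dg s t st.
- move=> x; rewrite in_itv/= => /andP[sx xt]; apply: derg.
  by rewrite (le_trans as_ (ltW sx)) (le_trans (ltW xt) tb).
- apply: continuous_in_subspaceT => r; rewrite inE/= in_itv/= => /andP[sx xt].
  suff : is_derive r 1 g (dg r) by apply: is_derive_continuous.
  by apply: derg; rewrite (le_trans as_ sx) (le_trans xt tb).
rewrite normrM [`|t - s|]ger0_norm ?subr_ge0// ler_pM ?subr_ge0// ?lerDr//.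
apply: dgK; move: cst; rewrite in_itv/= => /andP[sc ct].
by rewrite (le_trans as_ sc) (le_trans ct tb).
Qed.

Lemma dominated_lipschitz (g : R -> R) (M : R) : 0 <= M ->
  (forall s t, a <= s -> s <= t -> t <= b ->
     `|g t - g s| <= M * `|p t - p s|) ->
  dominated g.
Proof.
move=> M0 gM; exists M => // s t as_ st tb.
by rewrite (le_trans (gM _ _ as_ st tb))// ler_wpM2l// lerDl subr_ge0.
Qed.

End dominated.

(** * Lyapunov functions on a half-line *)

Section halfline.
Context (R : realType).
Implicit Types (V dV g : R -> R).

Lemma nonincreasing_from V dV (s0 : R) :
  (forall s, s0 <= s -> is_derive s 1 V (dV s)) ->
  (forall s, s0 <= s -> dV s <= 0) ->
  forall s t, s0 <= s -> s <= t -> V t <= V s.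
Proof.
move=> derV dV0 s t s0s st; apply: (@derive_le0_le _ _ dV) => //.
- apply: continuous_in_subspaceT => x; rewrite inE/= in_itv/= => /andP[sx _].
  by have /is_derive_continuous := derV x (le_trans s0s sx).
- by move=> x sx _; apply: derV; rewrite (le_trans s0s)// ltW.
- by move=> x sx _; apply: dV0; exact: (le_trans s0s sx).
Qed.

Lemma nonincreasing_cvg_pinfty V (s0 m : R) :
  (forall s t, s0 <= s -> s <= t -> V t <= V s) ->
  (forall s, s0 <= s -> m <= V s) ->
  cvg (V s @[s --> +oo]).
Proof.
move=> Vni Vm; pose A := V @` `[s0, +oo[.
have lA : lbound A m.
  by move=> _ [s /= + <-]; rewrite in_itv/= andbT; exact: Vm.
have iA : has_inf A.
  by split; [exists (V s0), s0 => //=; rewrite in_itv/= lexx|exists m].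
apply/cvg_ex; exists (inf A); apply/cvgrPdist_le => e e0.
have [_ [t /= + <-] Vt] := inf_adherent e0 iA.
rewrite in_itv/= andbT => s0t.
near=> s.
have ts : t <= s by near: s; apply: nbhs_pinfty_ge; exact: num_real.
have s0s := le_trans s0t ts.
have iV : inf A <= V s.
  by apply: ge_inf; [exists m|exists s => //=; rewrite in_itv/= andbT].
have := Vni _ _ s0t ts.
rewrite distrC ger0_norm ?subr_ge0//; lra.
Unshelve. all: by end_near. Qed.

(** If the limit were positive, the derivative of [V] would be below a multiple
    of [- 1 / s], and [V] would drop by a fixed amount between [s] and [2 s],
    however large [s] is; but [V] converges. *)
Lemma lyapunov_limit_le0 V dV g (s0 m l : R) : 0 < s0 ->
  (forall s, s0 <= s -> is_derive s 1 V (dV s)) ->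
  (forall s, s0 <= s -> m <= V s) ->
  (forall s, s0 <= s -> dV s <= 0) ->
  (forall s, s0 <= s -> dV s <= - (g s / s)) ->
  g s @[s --> +oo] --> l -> l <= 0.
Proof.
move=> s00 derV Vm dV0 dVg gl; rewrite leNgt; apply/negP => l0.
have Vni := nonincreasing_from derV dV0.
have /cvg_ex[v Vv] := nonincreasing_cvg_pinfty Vni Vm.
have l2 : l / 2 < l by lra.
have gl2 : \forall s \near +oo, l / 2 <= g s by exact: (@cvgr_ge _ _ _ _ _ l gl).
(* Below the drop [l / 4] of [V] between [s] and [2 s], with room to spare. *)
have l16 : 0 < l / 16 by lra.
have Vl : \forall s \near +oo, `|v - V s| <= l / 16 by exact: (@cvgrPdist_le _ _ _ _ _ V v).1.
have [S [_ SP]] : \forall s \near +oo,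
    [/\ s0 <= s, l / 2 <= g s & `|v - V s| <= l / 16].
  near=> s; split; near: s => //; apply: nbhs_pinfty_ge; exact: num_real.
pose s := Num.max S s0 + 1.
have Ss : S < s by rewrite /s ltr_pwDr// le_max lexx.
have [s0s _ Vs] := SP _ Ss.
have [_ _ V2s] := SP (2 * s) ltac:(lra).
have s2s : s < 2 * s by lra.
have [||c cst E] := @MVT_segment R V dV s (2 * s) (ltW s2s).
- move=> x; rewrite in_itv/= => /andP[sx _]; apply: derV.
  by rewrite (le_trans s0s)// ltW.
- apply: continuous_in_subspaceT => x; rewrite inE/= in_itv/= => /andP[sx _].
  by have /is_derive_continuous := derV x (le_trans s0s sx).
move: cst; rewrite in_itv/= => /andP[sc cs].
have [s0c gc _] := SP c (lt_le_trans Ss sc).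
have c0 : 0 < c by lra.
have : dV c <= - (l / 4 / s).
  apply: (le_trans (dVg _ s0c)); rewrite lerN2.
  rewrite ler_pdivrMr; last by lra.
  rewrite mulrAC ler_pdivlMr//.
  nra.
have sp : 0 < s by lra.
move=> dVc.
have : dV c * (2 * s - s) <= - (l / 4).
  have -> : - (l / 4) = - (l / 4 / s) * (2 * s - s) by field; rewrite gt_eqF.
  by rewrite ler_wpM2r//; lra.
rewrite -E => ?.
move: V2s Vs => /ler_normlW V2s; rewrite -normrN => /ler_normlW Vs.
move: Vs V2s; rewrite opprB; lra.
Unshelve. all: by end_near. Qed.

(** The primitive of [g] plus [V] is nonincreasing, so the primitive is bounded,
    hence convergent, and the integral over the half-line is its limit. *)
Lemma lyapunov_integral_lt_pinfty V dV g (s0 m : R) :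
  (forall s, s0 <= s -> is_derive s 1 V (dV s)) ->
  (forall s, s0 <= s -> m <= V s) ->
  (forall s, s0 <= s -> 0 <= g s) ->
  (forall s, s0 <= s -> dV s <= - g s) ->
  (forall s, s0 <= s -> {for s, continuous g}) ->
  (\int[@lebesgue_measure R]_(s in `[s0, +oo[) (g s)%:E < +oo)%E.
Proof.
move=> derV Vm g0 dVg cg.
have cgw a b : s0 <= a -> {within `[a, b], continuous g}.
  move=> s0a; apply: continuous_in_subspaceT => x; rewrite inE/= in_itv/= => /andP[sx _].
  by apply: cg; exact: le_trans sx.
pose F x := (\int[@lebesgue_measure R]_(t in `[s0, x]) g t)%R.
have intg b : (@lebesgue_measure R).-integrable `[s0, b] (EFin \o g).
  by apply: continuous_compact_integrable; [exact: segment_compact|exact: cgw].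
have dF x : s0 < x -> is_derive x 1 F (g x).
  move=> s0x; have x1 : x < x + 1 by rewrite ltrDl.
  have [dF Fg] := continuous_FTC1_closed x1 (intg (x + 1)) s0x (cg _ (ltW s0x)).
  by split; [exact: dF|rewrite -derive1E; exact: Fg].
have cF b : s0 <= b -> {within `[s0, b], continuous F}.
  by move=> s0b; exact: parameterized_integral_continuous.
have Fnd s t : s0 <= s -> s <= t -> - F t <= - F s.
  move=> s0s st; apply: (@derive_le0_le _ (fun x => - F x) (fun x => - g x)) => //.
  - apply: (@continuous_subspaceW _ _ _ `[s0, t]).
      by apply: subset_itv; rewrite bnd_simp.
    by move=> x; apply: continuousN; apply: cF; exact: le_trans st.
  - by move=> x sx _; have := dF x (le_lt_trans s0s sx); exact: is_deriveN.
  - by move=> x sx _; rewrite oppr_le0 g0// (le_trans s0s).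
have Fm s : s0 <= s -> - (F s0 + V s0 - m) <= - F s.
  move=> s0s; have : F s + V s <= F s0 + V s0.
    apply: (@derive_le0_le _ (F \+ V) (fun x => g x + dV x)) => //.
    - move=> x; apply: continuousD; first exact: cF.
      move: x; apply: continuous_in_subspaceT => x; rewrite inE/= in_itv/= => /andP[sx _].
      by have /is_derive_continuous := derV x sx.
    - move=> x sx _; apply: is_deriveD; [exact: dF|exact: derV (ltW sx)].
    - by move=> x sx _; have := dVg x sx; lra.
  by have := Vm s s0s; lra.
have /cvg_ex[l Fl] : cvg (F x @[x --> +oo]).
  have /cvg_ex[l Fl] := nonincreasing_cvg_pinfty Fnd Fm.
  apply/cvg_ex; exists (- l); rewrite (_ : F = fun x => - - F x).
    exact: cvgN.
  by apply/funext => x; rewrite opprK.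
have Fs0 : F x @[x --> s0^'+] --> F s0.
  have s01 : s0 < s0 + 1 by rewrite ltrDl.
  by have /(continuous_within_itvP _ s01)[_ ? _] := cF _ (ltW s01).
rewrite (@ge0_continuous_FTC2y _ g F s0 l) ?ltry//.
- by apply: continuous_in_subspaceT => x; rewrite inE/= in_itv/= andbT; exact: cg.
- by move=> x /dF[].
- by move=> x; rewrite in_itv/= andbT => /dF[_]; rewrite derive1E.
Qed.

End halfline.

(** * Inner products, Riesz representation and weak limits *)

Section inner_product.
Context (R : realType) (H : completeNormedModType R) (ip : {dot H for idfun}).
Hypothesis ipE : induces_norm ip.
Implicit Types u v w x : H.

Lemma ipC u v : ip u v = ip v u.
Proof.
by have := @hermitian_subproof _ _ false idfun ip u v; rewrite expr0 mul1r.
Qed.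

Lemma ipDl u v w : ip (u + v) w = ip u w + ip v w.
Proof. exact: linearDl. Qed.

Lemma ipDr u v w : ip w (u + v) = ip w u + ip w v.
Proof. by rewrite !(ipC w) ipDl. Qed.

Lemma ipZl (k : R) u w : ip (k *: u) w = k * ip u w.
Proof. exact: linearZl. Qed.

Lemma ipZr (k : R) u w : ip w (k *: u) = k * ip w u.
Proof. by rewrite !(ipC w) ipZl. Qed.

Lemma ipNl u w : ip (- u) w = - ip u w.
Proof. by rewrite -scaleN1r ipZl mulN1r. Qed.

Lemma ipNr u w : ip w (- u) = - ip w u.
Proof. by rewrite !(ipC w) ipNl. Qed.

Lemma ipBl u v w : ip (u - v) w = ip u w - ip v w.
Proof. by rewrite ipDl ipNl. Qed.

Lemma ipBr u v w : ip w (u - v) = ip w u - ip w v.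
Proof. by rewrite ipDr ipNr. Qed.

Lemma ip0l w : ip 0 w = 0.
Proof. by rewrite -(scale0r 0) ipZl mul0r. Qed.

Lemma ip0r w : ip w 0 = 0.
Proof. by rewrite ipC ip0l. Qed.

Definition ip_lin := (ipDl, ipDr, ipBl, ipBr, ipNl, ipNr, ipZl, ipZr).

(** The parameter [t] carries a sign, so one statement bounds the inner product
    from both sides and with any weights. *)
Lemma ip_young (t : R) u v : 2 * t * ip u v <= `|u| ^+ 2 + t ^+ 2 * `|v| ^+ 2.
Proof.
have : 0 <= `|u - t *: v| ^+ 2 by rewrite sqr_ge0.
by rewrite -!ipE !ip_lin (ipC v u); lra.
Qed.

Lemma ip_le u v : ip u v <= `|u| * `|v|.
Proof.
have [->|v0] := eqVneq v 0; first by rewrite ip0r normr0 mulr0.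
have nv : 0 < `|v| by rewrite normr_gt0.
have [->|u0] := eqVneq u 0; first by rewrite ip0l normr0 mul0r.
have nu : 0 < `|u| by rewrite normr_gt0.
have := ip_young (`|u| / `|v|) u v.
have -> : (`|u| / `|v|) ^+ 2 * `|v| ^+ 2 = `|u| ^+ 2.
  by field; rewrite gt_eqF.
have -> : 2 * (`|u| / `|v|) * ip u v = (2 * `|u| / `|v|) * ip u v by ring.
rewrite -ler_pdivlMl; last by rewrite !(mulr_gt0, invr_gt0).
move=> /le_trans; apply; rewrite le_eqVlt; apply/orP; left; apply/eqP.
by field; rewrite !gt_eqF.
Qed.

Lemma normr_ip u v : `|ip u v| <= `|u| * `|v|.
Proof. by rewrite ler_norml ip_le andbT lerNl -ipNl -(normrN u) ip_le. Qed.

Lemma cvg_ip (T : Type) (F : set_system T) {FF : Filter F} (u v : T -> H) x w :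
  u @ F --> x -> v @ F --> w -> ip (u s) (v s) @[s --> F] --> ip x w.
Proof.
move=> ux vw.
apply/subr_cvg0.
have key s : `|ip (u s) (v s) - ip x w| <= `|u s - x| * `|v s| + `|x| * `|v s - w|.
  have -> : ip (u s) (v s) - ip x w = ip (u s - x) (v s) + ip x (v s - w).
    by rewrite !ip_lin; ring.
  by rewrite (le_trans (ler_normD _ _))// lerD// normr_ip.
apply/norm_cvg0P.
apply: (@squeeze_cvgr _ _ _ _ (fun=> 0) (fun s => `|u s - x| * `|v s| + `|x| * `|v s - w|)).
- by apply: nearW => s; rewrite normr_ge0 key.
- exact: cvg_cst.
have -> : 0 = 0 * `|w| + `|x| * 0 :> R by rewrite mul0r mulr0 addr0.
apply: cvgD; apply: cvgM => //.
- by apply/norm_cvg0P/subr_cvg0.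
- exact: cvg_norm.
- exact: cvg_cst.
- by apply/norm_cvg0P/subr_cvg0.
Qed.

End inner_product.

Section riesz.
Context (R : realType) (H : completeNormedModType R) (ip : {dot H for idfun}).
Hypothesis ipE : induces_norm ip.
Implicit Types u v w x : H.

(** The representing vector is the minimizer of [|x|^2 / 2 - phi x].  Comparing
    an almost minimizer [u] with [u + t h] for the best [t] shows that [ip u]
    and [phi] almost agree, uniformly on bounded sets; applied to the difference
    of two almost minimizers, this makes a minimizing sequence Cauchy. *)
Lemma riesz_representation (phi : H -> R) (M : R) :
  (forall u v, phi (u + v) = phi u + phi v) ->
  (forall k u, phi (k *: u) = k * phi u) ->
  (forall u, `|phi u| <= M * `|u|) ->
  exists g, forall h, phi h = ip g h.
Proof.
move=> phiD phiZ phiM.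
have phi0 : phi 0 = 0 by rewrite -(scale0r (0 : H)) phiZ mul0r.
pose J u := `|u| ^+ 2 / 2 - phi u.
have Jlb : has_inf (range J).
  split; first by exists (J 0), 0.
  exists (- M ^+ 2 / 2) => _ [u _ <-]; rewrite /J.
  have := le_trans (ler_norm _) (phiM u).
  have : 0 <= (`|u| - M) ^+ 2 by rewrite sqr_ge0.
  lra.
have Jinf u : inf (range J) <= J u by apply: ge_inf; [exact: Jlb.2|exists u].
have key (e : R) : 0 < e -> exists u, forall h, (ip u h - phi h) ^+ 2 <= 2 * e * `|h| ^+ 2.
  move=> e0; have [_ [u _ <-] Ju] := inf_adherent e0 Jlb.
  exists u => h; set d := ip u h - phi h.
  have [h0|h0] := eqVneq h 0.
    by rewrite /d h0 normr0 ip0r// phi0 subrr !expr0n/= mulr0.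
  have nh : 0 < `|h| ^+ 2 by rewrite exprn_gt0// normr_gt0.
  (* The minimizer of the quadratic function [t d + t^2 |h|^2 / 2]. *)
  pose t := - d / `|h| ^+ 2.
  have := Jinf (u + t *: h); rewrite /J -ipE !ip_lin// phiD phiZ !ipE// (ipC _ h u) => Jt.
  move: Ju; rewrite /J => Ju.
  have : - e < t * d + t ^+ 2 * `|h| ^+ 2 / 2 by rewrite /d; lra.
  have -> : t * d + t ^+ 2 * `|h| ^+ 2 / 2 = - (d ^+ 2 / 2) / `|h| ^+ 2.
    by rewrite /t; field; rewrite gt_eqF// normr_gt0.
  by rewrite ltr_pdivlMr// => ?; lra.
pose e (n : nat) : R := n.+1%:R^-1.
have e0 n : 0 < e n by rewrite invr_gt0.
pose x n := projT1 (cid (key (e n) (e0 n))).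
have xP n h : (ip (x n) h - phi h) ^+ 2 <= 2 * e n * `|h| ^+ 2.
  by rewrite /x; case: cid => u /= ->.
have xx n m : `|x n - x m| ^+ 2 <= 4 * (e n + e m).
  set h := x n - x m.
  have [h0|h0] := eqVneq h 0.
    by rewrite h0 normr0 expr0n/= mulr_ge0// addr_ge0// ltW.
  have nh : 0 < `|h| ^+ 2 by rewrite exprn_gt0// normr_gt0.
  rewrite -(ler_pM2r nh) -expr2.
  have := xP n h; have := xP m h.
  have -> : `|h| ^+ 2 = (ip (x n) h - phi h) - (ip (x m) h - phi h).
    by rewrite -ipE {1}/h ipBl; ring.
  have := sqr_ge0 ((ip (x n) h - phi h) + (ip (x m) h - phi h)).
  lra.
have /cvg_ex[g xg] : cvg (x @ \oo).
  apply/cauchy_cvgP/cauchyP => eps eps0.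
  have eps8 : 0 < eps ^+ 2 / 8 by rewrite divr_gt0// exprn_gt0.
  have [N _ NP] := near_infty_natSinv_lt (PosNum eps8).
  exists (x N); exists N => // n /= Nn; rewrite -ball_normE/=.
  rewrite -(@ltr_pXn2r _ 2)// ?nnegrE// ?(ltW eps0)//.
  apply: (le_lt_trans (xx _ _)).
  have eN : e N < eps ^+ 2 / 8 by exact: NP N (leqnn N).
  have en : e n < eps ^+ 2 / 8 by exact: NP n Nn.
  lra.
exists g => h; apply/esym/eqP; rewrite -subr_eq0 -sqrf_eq0; apply/eqP.
have c1 : (ip (x n) h - phi h) ^+ 2 @[n --> \oo] --> (ip g h - phi h) ^+ 2.
  rewrite expr2; under eq_fun do rewrite expr2.
  have c0 : (ip (x n) h - phi h) @[n --> \oo] --> ip g h - phi h.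
    apply: cvgB; last exact: cvg_cst.
    by apply: cvg_ip => //; exact: cvg_cst.
  exact: cvgM.
have c2 : 2 * e n * `|h| ^+ 2 @[n --> \oo] --> (0 : R).
  rewrite -[X in _ --> X](mul0r (`|h| ^+ 2)); apply: cvgMr_tmp.
  rewrite -[X in _ --> X](mulr0 2); apply: cvgMl_tmp.
  exact: cvg_harmonic.
apply/eqP; rewrite eq_le sqr_ge0 andbT.
by apply: (ler_cvg_to c1 c2); apply: nearW => n; exact: xP.
Qed.

Lemma linear_bounded_ex (V W : normedModType R) (phi : {linear V -> W}) :
  continuous phi -> exists M, forall z, `|phi z| <= M * `|z|.
Proof.
move=> /linear_bounded_continuous/linear_boundedP/pinfty_ex_gt0[M _ ?].
by exists M.
Qed.

Lemma riesz_linear (phi : {linear H -> R^o}) : continuous phi ->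
  exists g, forall h, phi h = ip g h.
Proof.
move=> /linear_bounded_ex[M phiM]; apply: (@riesz_representation phi M) => //.
- exact: linearD.
- by move=> k u; rewrite linearZ.
Qed.

Lemma ultra_fmap (T U : Type) (f : T -> U) (F : set_system T) :
  UltraFilter F -> UltraFilter (f @ F).
Proof.
move=> FU; split; first exact: fmap_proper_filter.
move=> G GP FG; apply/seteqP; split => // A GA.
have [//|FcA] := in_ultra_setVsetC (f @^-1` A) FU.
have /FG GcA : (f @ F) (~` A) by [].
have : G (A `&` ~` A) by exact: filterI.
by rewrite setICr => /filter_not_empty.
Qed.

Lemma ultra_bounded_cvg (T : Type) (U : set_system T) (g : T -> R) (M : R) :
  UltraFilter U -> (\forall s \near U, `|g s| <= M) ->
  exists l : R, g @ U --> l.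
Proof.
move=> UU gM.
have := @segment_compact R (- M) M; rewrite compact_ultra.
move=> /(_ (g @ U) (ultra_fmap g UU)) [].
  by near do rewrite /= in_itv/= -ler_norml.
by move=> l [_ ?]; exists l.
Unshelve. all: by end_near. Qed.

(** Weak compactness of bounded sets, read along an ultrafilter: all the scalar
    functions [ip (u s) v] converge simultaneously, and their limit is a bounded
    linear functional of [v]. *)
Lemma ultra_weak_limit (T : Type) (U : set_system T) (u : T -> H) (M : R) :
  UltraFilter U -> (\forall s \near U, `|u s| <= M) ->
  exists p, forall v, ip (u s) v @[s --> U] --> ip p v.
Proof.
move=> UU uM.
have bnd v : \forall s \near U, `|ip (u s) v| <= M * `|v|.
  near=> s; rewrite (le_trans (normr_ip ipE _ _))// ler_wpM2r//.
  by near: s.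
have cv v := ultra_bounded_cvg UU (bnd v).
pose L v := projT1 (cid (cv v)).
have LP v : ip (u s) v @[s --> U] --> L v by rewrite /L; case: cid.
have [|||p Lp] := @riesz_representation L M.
- move=> v w; apply: (cvg_unique _ (LP (v + w))) => //.
  rewrite (_ : (fun s => _) = (fun s => ip (u s) v + ip (u s) w)).
    by apply: cvgD; exact: LP.
  by apply/funext => s; rewrite ipDr.
- move=> k v; apply: (cvg_unique _ (LP (k *: v))) => //.
  rewrite (_ : (fun s => _) = (fun s => k * ip (u s) v)).
    by apply: cvgMl_tmp; exact: LP.
  by apply/funext => s; rewrite ipZr.
- move=> v; have /cvg_norm nL := LP v.
  exact: (cvgr_to_le nL (bnd v)).
by exists p => v; rewrite -Lp.
Unshelve. all: by end_near. Qed.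

End riesz.

(** If some neighborhood of the limit were not in the image filter, [F] could be
    refined by the complement of its preimage. *)
Lemma ultra_cvg_to (T : Type) (V : topologicalType) (F : set_system T)
    (g : T -> V) (l : V) : ProperFilter F ->
  (forall U, UltraFilter U -> F `<=` U -> g @ U --> l) -> g @ F --> l.
Proof.
move=> FF gU A lA; apply: contrapT => nFA.
have WP : ProperFilter (within (~` (g @^-1` A)) F).
  apply: Build_ProperFilter_ex => B WB; apply: contrapT => /forallNP B0.
  apply: nFA; move: WB; rewrite /within/=; apply: filterS => s sB; apply: contrapT => /sB.
  exact: B0.
have [U [UU WU]] := ultraFilterLemma WP.
have FU : F `<=` U.
  by move=> B FB; apply: WU; rewrite /within/=; apply: filterS FB.
have UA : U (g @^-1` A) by exact: gU U UU FU A lA.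
have UcA : U (~` (g @^-1` A)) by apply: WU; exact: withinT.
have : U ((g @^-1` A) `&` ~` (g @^-1` A)) by exact: filterI.
by rewrite setICr => /filter_not_empty.
Qed.

Section opial.
Context (R : realType) (H : completeNormedModType R) (ip : {dot H for idfun}).
Hypothesis ipE : induces_norm ip.

(** Two weak cluster points [p] and [p'] both lie in [S], so
    [|x - p|^2 - |x - p'|^2] converges along [F], and so does [ip x (p - p')],
    which differs from it by a constant and a factor [- 2].  The limit is
    [ip p (p - p')] along one ultrafilter and [ip p' (p - p')] along the other;
    their equality gives [p = p']. *)
Lemma opial (T : Type) (F : set_system T) (FF : ProperFilter F)
    (x : T -> H) (S : set H) :
  S !=set0 ->
  (forall z, S z -> cvg (`|x s - z| ^+ 2 @[s --> F])) ->
  (forall U p, UltraFilter U -> F `<=` U ->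
     (forall v, ip (x s) v @[s --> U] --> ip p v) -> S p) ->
  exists2 p, S p & forall v, ip (x s) v @[s --> F] --> ip p v.
Proof.
move=> [z0 Sz0] xcvg Scl.
have [M xM] : exists M, \forall s \near F, `|x s| <= M.
  have /cvg_ex[/= l xl] := xcvg _ Sz0.
  exists (l + 1 + 1 + `|z0|).
  have l1 : l < l + 1 by rewrite ltrDl.
  have xb : \forall s \near F, `|x s - z0| ^+ 2 <= l + 1 by exact: (@cvgr_le _ _ _ _ _ l xl).
  move: xb.
  apply: filterS => s xs.
  have -> : x s = (x s - z0) + z0 by rewrite subrK.
  rewrite (le_trans (ler_normD _ _))// lerD2r.
  have := sqr_ge0 (`|x s - z0| - 1).
  have := normr_ge0 (x s - z0).
  by nra.
have lim U : UltraFilter U -> F `<=` U ->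
    exists2 p, S p & forall v, ip (x s) v @[s --> U] --> ip p v.
  move=> UU FU; have [|p xp] := @ultra_weak_limit R H ip ipE _ U x M UU.
    exact: FU.
  by exists p => //; exact: Scl UU FU xp.
have [U0 [UU0 FU0]] := ultraFilterLemma FF.
have [p Sp xp] := lim U0 UU0 FU0.
exists p => // v; apply: ultra_cvg_to => U UU FU.
have [p' Sp' xp'] := lim U UU FU.
suff -> : p = p' by exact: xp'.
have /cvg_ex[/= l xl] := xcvg _ Sp.
have /cvg_ex[/= l' xl'] := xcvg _ Sp'.
have dcvg : ip (x s) (p - p') @[s --> F] -->
    (`|p| ^+ 2 - `|p'| ^+ 2 - (l - l')) / 2.
  rewrite (_ : (fun s => _) = fun s =>
     (`|p| ^+ 2 - `|p'| ^+ 2 - (`|x s - p| ^+ 2 - `|x s - p'| ^+ 2)) / 2).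
    by apply: cvgMr_tmp; apply: cvgB; [exact: cvg_cst|exact: cvgB].
  by apply/funext => s; rewrite -!ipE !(ip_lin ip) !(ipC _ _ (x s)) /=; field.
have eq1 : ip p (p - p') = (`|p| ^+ 2 - `|p'| ^+ 2 - (l - l')) / 2.
  apply: (cvg_unique _ (xp (p - p'))) => //.
  by apply: cvg_trans dcvg => A; exact: FU0.
have eq2 : ip p' (p - p') = (`|p| ^+ 2 - `|p'| ^+ 2 - (l - l')) / 2.
  apply: (cvg_unique _ (xp' (p - p'))) => //.
  by apply: cvg_trans dcvg => A; exact: FU.
apply/eqP; rewrite -subr_eq0 -normr_eq0 -sqrf_eq0 -ipE ipBl eq1 eq2 subrr.
by [].
Qed.

End opial.

(** * Curves in a Hilbert space and gradients of convex functions *)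

Section hilbert_calculus.
Context (R : realType) (H : completeNormedModType R) (ip : {dot H for idfun}).
Hypothesis ipE : induces_norm ip.

Lemma is_derive_scale (V : normedModType R) (g : R -> R) (s dg : R) (c : V) :
  is_derive s 1 g dg -> is_derive s 1 (fun t => g t *: c) (dg *: c).
Proof.
move=> /is_derive1_cvgP dg'; apply/is_derive1_cvgP.
rewrite (_ : (fun h => _) = (fun h => (h^-1 *: (g (h + s) - g s)) *: c)).
  exact: cvgZr_tmp.
by apply/funext => h; rewrite -scalerBl scalerA.
Qed.

Lemma is_derive_ip (u w : R -> H) (s : R) (du dw : H) :
  is_derive s 1 u du -> is_derive s 1 w dw ->
  is_derive s 1 (fun t => ip (u t) (w t)) (ip du (w s) + ip (u s) dw).
Proof.
move=> du' dw'; have cw := is_derive_continuous dw'.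
apply/is_derive1_cvgP.
rewrite (_ : (fun h => _) = (fun h => ip (h^-1 *: (u (h + s) - u s)) (w (h + s))
    + ip (u s) (h^-1 *: (w (h + s) - w s)))); last first.
  by apply/funext => h; rewrite !(ip_lin ip) [LHS]mulrDr; ring.
move: du' dw' => /is_derive1_cvgP du' /is_derive1_cvgP dw'.
apply: cvgD; apply: cvg_ip => //; last exact: cvg_cst.
have /cvg_comp : h + s @[h --> 0^'] --> s.
  rewrite -[X in _ --> X]add0r; apply: cvgD; last exact: cvg_cst.
  exact: nbhs_dnbhs.
by apply.
Qed.

Lemma is_derive_sqnorm (u : R -> H) (s : R) (du z : H) :
  is_derive s 1 u du ->
  is_derive s 1 (fun t => `|u t - z| ^+ 2) (2 * ip du (u s - z)).
Proof.
move=> du'; have du'' : is_derive s 1 (fun t => u t - z) du.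
  rewrite -[du]subr0; apply: is_deriveB.
have := is_derive_ip du'' du''.
rewrite (_ : (fun t => ip _ _) = (fun t => `|u t - z| ^+ 2)); last first.
  by apply/funext => t; rewrite ipE.
by rewrite (ipC _ _ du) mulr2n mulrDl mul1r.
Qed.

(** The mean value inequality, obtained from the scalar mean value theorem by
    pairing the curve with its own increment. *)
Lemma derive_bounded_lipschitz (u du : R -> H) (K a b : R) :
  (forall s, a <= s <= b -> is_derive s 1 u (du s)) ->
  (forall s, a <= s <= b -> `|du s| <= K) ->
  forall s t, a <= s -> s <= t -> t <= b -> `|u t - u s| <= K * (t - s).
Proof.
move=> deru duK s t sa st tb.
set w := u t - u s.
have [->|w0] := eqVneq w 0.
  rewrite normr0 mulr_ge0 ?subr_ge0//.
  have := duK s; rewrite sa (le_trans st) // => /(_ isT); exact: le_trans.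
have der x : a <= x <= b -> is_derive x 1 (fun r => ip (u r) w) (ip (du x) w).
  move=> /deru xu; rewrite -[X in is_derive _ _ _ X]addr0.
  rewrite -[X in _ + X](ip0r ip (u x)).
  exact: is_derive_ip.
have inab x : x \in `[s, t] -> a <= x <= b.
  by rewrite in_itv/= => /andP[sx xt]; rewrite (le_trans sa)// (le_trans xt).
have [||c cst E] := @MVT_segment R (fun r => ip (u r) w) (fun r => ip (du r) w) s t st.
- by move=> x xst; apply: der; apply: inab; exact: subset_itv_oo_cc xst.
- apply: continuous_in_subspaceT => x; rewrite inE/= => xst.
  by have /is_derive_continuous := der x (inab _ xst).
have nw : 0 < `|w| by rewrite normr_gt0.
rewrite -(ler_pM2r nw) -expr2 -ipE {1}/w ipBl E mulrAC.
rewrite ler_wpM2r ?subr_ge0// (le_trans (ip_le ipE _ _))// ler_wpM2r//.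
by apply: duK; exact: inab.
Qed.

End hilbert_calculus.

Section gradient.
Context (R : realType) (H : completeNormedModType R) (ip : {dot H for idfun}).
Hypothesis ipE : induces_norm ip.
Variable f : H -> R.

Lemma gradientE x h : differentiable f x -> 'd f x h = ip (gradient ip f x) h.
Proof.
move=> df; have [g gE] := riesz_linear ipE (diff_continuous df).
have := @getPex _ [set g : H | forall h : H, 'd f x h = ip g h].
by apply; exists g.
Qed.

Lemma is_derive_gradient (u : R -> H) (s : R) (du : H) :
  differentiable f (u s) -> is_derive s 1 u du ->
  is_derive s 1 (fun t => f (u t)) (ip (gradient ip f (u s)) du).
Proof.
move=> df [du1 duE]; have du' : differentiable u s by exact/derivable1_diffP.
have dc : differentiable (f \o u) s by exact: differentiable_comp.
split; first exact/derivable1_diffP.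
by rewrite (deriveE _ dc) diff_comp//= -(deriveE _ du') duE gradientE.
Qed.

Hypothesis fdiff : forall x, differentiable f x.
Hypothesis fconv : convex_function (E := H) setT f.

Lemma convex_segment x z (t : R) : 0 <= t -> t <= 1 ->
  f (t *: (z - x) + x) <= f x + t * (f z - f x).
Proof.
move=> t0 t1.
have fle : f (t *: z + (1 - t) *: x) <= t * f z + (1 - t) * f x.
  exact: (@fconv (Itv01 t0 t1) z x (in_setT _) (in_setT _)).
have -> : t *: (z - x) + x = t *: z + (1 - t) *: x.
  by rewrite scalerBl scale1r scalerBr -addrA; congr (_ + _); rewrite addrC.
by apply: (le_trans fle); lra.
Qed.

(** The difference quotients along the segment from [x] to [z] are at most
    [f z - f x] by convexity. *)
Lemma convex_gradient_le x z : f x + ip (gradient ip f x) (z - x) <= f z.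
Proof.
rewrite -gradientE// -deriveE//.
suff : 'D_(z - x) f x <= f z - f x by lra.
have /cvg_dnbhs_at_right := (@diff_derivable _ _ _ f x (z - x) (fdiff x)).
move=> /cvgr_to_le; apply; near=> h.
have h0 : 0 < h by [].
have h1 : h <= 1 by near: h; exact: nbhs_right_le.
rewrite /= -ler_pdivlMl ?invr_gt0// invrK.
by have := convex_segment x z (ltW h0) h1; lra.
Unshelve. all: by end_near. Qed.

Lemma gradient_monotone x z :
  0 <= ip (gradient ip f z - gradient ip f x) (z - x).
Proof.
rewrite ipBl subr_ge0 -(lerD2l (f x)) (le_trans (convex_gradient_le x z))//.
by rewrite -lerBlDr -ipNr opprB convex_gradient_le.
Qed.

Hypothesis flip :
  forall B : set H, bounded_set B -> [lipschitz gradient ip f x | x in B].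

Lemma gradient_lipschitz_ball (K : R) : exists2 M, 0 < M &
  forall x x', `|x| <= K -> `|x'| <= K ->
    `|gradient ip f x - gradient ip f x'| <= M * `|x - x'|.
Proof.
have /flip : bounded_set [set x : H | `|x| <= K].
  by exists K; split; [exact: num_real|move=> N KN x /= xK; rewrite (le_trans xK)// ltW].
move=> /pinfty_ex_gt0[M M0 fM]; exists M => // x x' xK x'K.
exact: (fM (x, x')).
Qed.

Lemma gradient_continuous : continuous (gradient ip f).
Proof.
move=> x; have [M M0 fM] := gradient_lipschitz_ball (`|x| + 1).
apply/cvgrPdist_le => e e0.
near=> x'.
have xx' : `|x - x'| <= Num.min 1 (e / M).
  near: x'; apply: (@cvgrPdist_le _ _ _ (nbhs x) _ id x).1 => //.
  by rewrite lt_min ltr01 divr_gt0.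
move: xx'; rewrite le_min => /andP[xx1 xxe].
apply: (le_trans (fM _ _ _ _)).
- by rewrite lerDl.
- have -> : x' = x - (x - x') by rewrite opprB addrC subrK.
  by rewrite (le_trans (ler_normB _ _))// lerD2l.
- by rewrite mulrC -ler_pdivlMr.
Unshelve. all: by end_near. Qed.

End gradient.

(** * The trajectory: reduction to a first-order equation *)

Section trajectory.
Context (R : realType) (H : completeNormedModType R) (ip : {dot H for idfun}).
Hypothesis ipE : induces_norm ip.
Variables (f : H -> R) (s0 alpha : R) (y v : R -> H).
Implicit Types s t : R.
Hypothesis fdiff : forall x, differentiable f x.
Hypothesis fconv : convex_function (E := H) setT f.
Hypothesis flip :
  forall B : set H, bounded_set B -> [lipschitz gradient ip f x | x in B].
Hypothesis s00 : 0 < s0.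
Hypothesis alpha1 : 1 < alpha.
Hypothesis yv : forall s, s0 <= s -> is_derive s 1 y (v s).
Hypothesis vc : forall s, s0 <= s -> {for s, continuous v}.
Hypothesis vac : forall a b, s0 <= a -> abs_continuous a b v.
Let G s := gradient ip f (y s).
Hypothesis ode : {ae (@lebesgue_measure R), forall s, s0 < s ->
  exists v' G', [/\ is_derive s 1 v v', is_derive s 1 G G' &
    v' + (alpha / s) *: v s + (s / (alpha + 1)) *: G' + G s = 0]}.

Let sge0 s : s0 <= s -> 0 < s. Proof. exact: lt_le_trans. Qed.

Lemma trajectory_gradient_continuous s : s0 <= s -> {for s, continuous G}.
Proof.
move=> /yv/is_derive_continuous ys.
by apply: continuous_comp => //; exact: (gradient_continuous flip).
Qed.

Lemma trajectory_gradient_lipschitz b : exists2 L, 0 <= L &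
  forall s t, s0 <= s -> s <= t -> t <= b -> `|G t - G s| <= L * (t - s).
Proof.
have [|K K0 yK] := @continuous_itv_bounded _ H y s0 b.
  by move=> s /andP[/yv/is_derive_continuous].
have [|N N0 vN] := @continuous_itv_bounded _ H v s0 b.
  by move=> s /andP[/vc].
have [M M0 fM] := gradient_lipschitz_ball flip K.
exists (M * N); first by rewrite mulr_ge0// ltW.
move=> s t ss st tb.
apply: (le_trans (fM _ _ _ _)).
- by rewrite yK// tb (le_trans ss st).
- by rewrite yK// ss (le_trans st tb).
rewrite -mulrA ler_pM2l//.
apply: (derive_bounded_lipschitz ipE _ vN) ss st tb.
by move=> r /andP[/yv].
Qed.

Definition weight s := s `^ alpha.

Lemma weight_gt0 s : 0 < s -> 0 < weight s. Proof. exact: powR_gt0. Qed.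

Lemma is_derive_weight s : 0 < s -> is_derive s 1 weight (alpha * weight s / s).
Proof.
move=> s_gt0; have -> : alpha * weight s / s = alpha * s `^ (alpha - 1).
  rewrite -mulrA; congr (_ * _); rewrite /weight -{2}(powRr1 (ltW s_gt0)) -powRN -powRD//.
  by rewrite (gt_eqF s_gt0) implybT.
exact: is_derive1_powR.
Qed.

(** Tested against the vector [w = h s - h s0], the exact derivative [h] of the
    equation gives a scalar absolutely continuous function with zero derivative
    almost everywhere; its values at [s0] and [s] differ by [|w|^2]. *)
Lemma ode_first_order : exists C : H, forall s, s0 <= s ->
  v s = - (s / (alpha + 1)) *: G s + (weight s)^-1 *: C.
Proof.
(* [n s = s^(alpha + 1) / (alpha + 1)] is the primitive of [weight]. *)
pose n s := (alpha + 1)^-1 * (s * weight s).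
have a1 : 0 < alpha + 1 by move: alpha1; lra.
have dern (s : R) : 0 < s -> is_derive s 1 n (weight s).
  move=> s_gt0.
  have := is_derive_mulC (alpha + 1)^-1 (is_derive_mul (is_derive_id s 1) (is_derive_weight s_gt0)).
  by move/is_derive_eq; apply; field; rewrite !gt_eqF.
pose h s := weight s *: v s + n s *: G s.
have hphi r u : ip (h r) u = weight r * ip (v r) u + n r * ip (G r) u.
  by rewrite !(ip_lin ip).
exists (h s0) => s s0s; have sp := sge0 s0s.
suff <- : h s = h s0.
  rewrite /h scalerDr !scalerA mulVf ?gt_eqF ?weight_gt0// scale1r addrCA -scalerDl /n.
  rewrite [X in X *: _](_ : _ = 0) ?scale0r ?addr0//.
  by field; rewrite !gt_eqF ?weight_gt0.
have [w wE] : exists w, w = h s - h s0 by exists (h s - h s0).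
apply/eqP; rewrite -subr_eq0 -normr_eq0 -sqrf_eq0.
rewrite -wE eq_le sqr_ge0 andbT -ipE {1}wE ipBl subr_le0.
have ipc (u : R -> H) r : {for r, continuous u} ->
    {for r, continuous (fun t => ip (u t) w)}.
  by move=> cu; apply: (@cvg_ip R H ip ipE R (nbhs r) _ u (fun=> w) (u r) w cu (cvg_cst _)).
pose phi r := weight r * ip (v r) w + n r * ip (G r) w.
rewrite (hphi s) (hphi s0).
apply: (@ac_ae_nonincreasing _ s0 s phi s0s).
  apply: (dominated_abs_continuous (vac s (lexx s0))).
  have wcont r : s0 <= r <= s -> {for r, continuous weight}.
    by move=> /andP[/sge0/is_derive_weight/is_derive_continuous].
  have ncont r : s0 <= r <= s -> {for r, continuous n}.
    by move=> /andP[/sge0/dern/is_derive_continuous].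
  have [L L0 GL] := trajectory_gradient_lipschitz s.
  apply: dominatedD; apply: dominatedM => //.
  - by move=> r /andP[rs _]; apply: ipc; exact: vc.
  - apply: (dominated_derive _ (dg := fun r => alpha * weight r / r)).
      by move=> r /andP[/sge0/is_derive_weight].
    move=> r /andP[/sge0 r0 _]; have rn0 : r != 0 by rewrite gt_eqF.
    have := is_derive_mul (is_derive_mulC alpha (is_derive_weight r0))
      (is_derive_inv rn0 (is_derive_id r 1)).
    exact: is_derive_continuous.
  - apply: (dominated_lipschitz (M := `|w|)) => // r t _ _ _.
    by rewrite -ipBl mulrC; exact: normr_ip.
  - by move=> r /andP[rs _]; apply: ipc; exact: trajectory_gradient_continuous.
  - apply: (dominated_derive _ (dg := weight)) => //.
    by move=> r /andP[/sge0/dern].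
  - exists (L * `|w|) => [|r t rs rt ts]; first by rewrite mulr_ge0.
    rewrite -ipBl (le_trans (normr_ip ipE _ _))// mulrAC ler_wpM2r//.
    by rewrite (le_trans (GL _ _ rs rt ts))// ler_wpM2l// lerDr.
move: ode; apply: filterS; first exact: (ae_filter_ringOfSetsType lebesgue_measure).
move=> r odeR /andP[s0r rs]; exists 0 => //.
have [v' [G' [dv dG E]]] := odeR s0r.
have r_gt0 := lt_trans s00 s0r.
have dipv := is_derive_ip ipE dv (is_derive_cst w r 1).
have dipG := is_derive_ip ipE dG (is_derive_cst w r 1).
have := is_derive_add (is_derive_mul (is_derive_weight r_gt0) dipv)
  (is_derive_mul (dern r r_gt0) dipG).
move/is_derive_eq; apply; rewrite !(ip0r ip) !addr0.
have /(congr1 (fun u => weight r * ip u w)) := E.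
rewrite !(ip_lin ip) (ip0l ip) mulr0 => <-; rewrite /n.
by field; rewrite !gt_eqF.
Qed.

(** * The perturbation and the Lyapunov energy *)

Let beta := (alpha + 1)^-1.

Let alpha1_gt0 : 0 < alpha - 1. Proof. by rewrite subr_gt0. Qed.

Let alphaD_gt0 : 0 < alpha + 1. Proof. by rewrite addr_gt0// (lt_trans ltr01). Qed.

Let beta_gt0 : 0 < beta. Proof. by rewrite invr_gt0. Qed.

(** The integral of [r^(- alpha)] over [r >= s]. *)
Definition tail s := s / ((alpha - 1) * weight s).

Lemma tail_gt0 s : 0 < s -> 0 < tail s.
Proof. by move=> s_gt0; rewrite divr_gt0// mulr_gt0// weight_gt0. Qed.

Lemma is_derive_tail s : 0 < s -> is_derive s 1 tail (- (weight s)^-1).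
Proof.
move=> s_gt0; have am0 : (alpha - 1) * weight s != 0.
  by rewrite mulf_neq0// gt_eqF// weight_gt0.
have := is_derive_mul (is_derive_id s 1)
  (is_derive_inv (g := fun x => (alpha - 1) * weight x) am0
    (is_derive_mulC (alpha - 1) (is_derive_weight s_gt0))).
move/is_derive_eq; apply; field.
by rewrite !gt_eqF ?weight_gt0.
Qed.

(** The tail is itself a Lyapunov function: its derivative is
    [- (alpha - 1) tail s / s]. *)
Lemma tail_cvg0 : tail s @[s --> +oo] --> 0.
Proof.
have dtail s : s0 <= s -> is_derive s 1 tail (- (weight s)^-1) by move=> /sge0/is_derive_tail.
have tailge0 s : s0 <= s -> 0 <= tail s by move=> /sge0/tail_gt0/ltW.
have dtail0 s : s0 <= s -> - (weight s)^-1 <= 0.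
  by move=> /sge0 s_gt0; rewrite oppr_le0 invr_ge0 ltW// weight_gt0.
have /cvg_ex[l tl] := nonincreasing_cvg_pinfty (nonincreasing_from dtail dtail0) tailge0.
have l0 : 0 <= l.
  by apply: (cvgr_to_ge tl); exists s0; split; [exact: num_real|move=> s /ltW; exact: tailge0].
have : (alpha - 1) * l <= 0.
  apply: (lyapunov_limit_le0 (g := fun s => (alpha - 1) * tail s) s00 dtail tailge0 dtail0).
    move=> s /sge0 s_gt0; rewrite lerN2 le_eqVlt; apply/orP; left; apply/eqP.
    by rewrite /tail; field; rewrite !gt_eqF ?weight_gt0.
  exact: cvgMl_tmp.
rewrite pmulr_rle0// => l0'; suff -> : 0 = l by [].
by apply/eqP; rewrite eq_le l0 l0'.
Qed.

Section shifted_flow.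
Variable C : H.
Hypothesis vE : forall s, s0 <= s ->
  v s = - (s / (alpha + 1)) *: G s + (weight s)^-1 *: C.

Definition shifted s := y s + tail s *: C.

Lemma is_derive_shifted s : s0 <= s ->
  is_derive s 1 shifted (- (s / (alpha + 1)) *: G s).
Proof.
move=> s0s; have := is_deriveD (yv s0s) (is_derive_scale C (is_derive_tail (sge0 s0s))).
by move/is_derive_eq; apply; rewrite vE// [X in _ + X]scaleNr addrK.
Qed.

Section minimizer.
Variable z : H.
Hypothesis fz : argmin f z.

Definition gap s := f (y s) - f z.

Lemma gap_ge0 s : 0 <= gap s. Proof. by rewrite subr_ge0. Qed.

Lemma gap_le s : gap s <= ip (G s) (y s - z).
Proof.
have := convex_gradient_le ipE fdiff fconv (y s) z.
by rewrite -(opprB (y s)) ipNr /gap; lra.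
Qed.

Lemma is_derive_gap s : s0 <= s -> is_derive s 1 gap (ip (G s) (v s)).
Proof.
move=> s0s; rewrite -[X in is_derive _ _ _ X]subr0.
by apply: is_deriveB; exact: is_derive_gradient (yv s0s).
Qed.

Lemma ip_gradient_speed s : s0 <= s ->
  ip (G s) (v s) = - (s * beta) * `|G s| ^+ 2 + ip (G s) C / weight s.
Proof. by move=> s0s; rewrite vE// !(ip_lin ip) ipE mulrC [_^-1 * _]mulrC; ring. Qed.

(** Twice [kappa tail / weight] is the remainder of Young's inequality in
    [denergy_le]. *)
Definition kappa theta :=
  (alpha - 1) * ((theta - 2 * beta / (alpha - 1)) * `|C|) ^+ 2 / (4 * theta * beta).

Definition energy theta s :=
  `|shifted s - z| ^+ 2 + theta * (s ^+ 2 * gap s) + kappa theta * tail s ^+ 2.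

Definition denergy theta s :=
  2 * ip (- (s / (alpha + 1)) *: G s) (shifted s - z)
  + theta * (2 * s * 1 * gap s + s ^+ 2 * ip (G s) (v s))
  + kappa theta * (2 * tail s * - (weight s)^-1).

Lemma is_derive_energy theta s : s0 <= s ->
  is_derive s 1 (energy theta) (denergy theta s).
Proof.
move=> s0s; apply: is_derive_add; first apply: is_derive_add.
- by apply: (is_derive_sqnorm ipE z); exact: is_derive_shifted.
- apply: is_derive_mulC; apply: is_derive_mul; last exact: is_derive_gap.
  by apply: is_derive_sqr; exact: is_derive_id.
- by apply: is_derive_mulC; apply: is_derive_sqr; apply: is_derive_tail; exact: sge0.
Qed.

Lemma kappa_ge0 theta : 0 < theta -> 0 <= kappa theta.
Proof.
move=> t0; apply: divr_ge0; first by rewrite mulr_ge0 ?sqr_ge0// ltW.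
by rewrite ltW// !mulr_gt0.
Qed.

Lemma energy_ge0 theta s : 0 < theta -> s0 <= s -> 0 <= energy theta s.
Proof.
move=> t0 s0s; apply: addr_ge0; first apply: addr_ge0.
- exact: sqr_ge0.
- by rewrite mulr_ge0 ?(ltW t0)// mulr_ge0 ?sqr_ge0// gap_ge0.
- by rewrite mulr_ge0 ?sqr_ge0// kappa_ge0.
Qed.

(** Only the terms containing [ip (G s) C] have no sign.  Since
    [s tail s = s^2 / ((alpha - 1) weight s)], they add up to
    [c s^2 / weight s * ip (G s) C]; half of [theta beta s^3 |G s|^2] absorbs
    them, with a remainder which the derivative of [kappa tail^2] cancels. *)
Lemma denergy_le theta s : 0 < theta -> s0 <= s ->
  denergy theta s <=
  - (2 * (beta - theta) * (s * gap s) + theta * beta / 2 * (s ^+ 3 * `|G s| ^+ 2)).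
Proof.
move=> t0 s0s; have s_gt0 := sge0 s0s; have m0 := weight_gt0 s_gt0.
have b0 := beta_gt0.
pose c := theta - 2 * beta / (alpha - 1).
(* The weight that turns [theta beta s^3 / 2] times the left-hand side into the
   terms in [ip (G s) C]. *)
have yg := ip_young ipE (c / (theta * beta * s * weight s)) (G s) C.
have tb0 : 0 < theta * beta * s ^+ 3 / 2.
  by rewrite !(divr_gt0, mulr_gt0, exprn_gt0).
move: yg; rewrite -(ler_pM2l tb0) => yg.
have Wz : s * beta * gap s <= s * beta * ip (G s) (y s - z).
  by rewrite ler_wpM2l ?gap_le// mulr_ge0 ?ltW.
have Ez : ip (- (s / (alpha + 1)) *: G s) (shifted s - z) =
    - (s * beta) * (ip (G s) (y s - z) + tail s * ip (G s) C).
  by rewrite /shifted /beta !(ip_lin ip); ring.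
rewrite /denergy ip_gradient_speed// Ez.
set gc := ip (G s) C in yg *; set g2 := `|G s| ^+ 2 in yg *.
set gz := ip (G s) (y s - z) in Wz *.
have E1 : theta * beta * s ^+ 3 / 2 * (2 * (c / (theta * beta * s * weight s)) * gc)
   = theta * s ^+ 2 / weight s * gc - 2 * (s * beta) * (tail s * gc).
  by rewrite /c /tail; field; rewrite !gt_eqF.
have E2 : theta * beta * s ^+ 3 / 2 * ((c / (theta * beta * s * weight s)) ^+ 2 * `|C| ^+ 2)
   = kappa theta * (2 * tail s * (weight s)^-1).
  by rewrite /kappa -/c /tail; field; rewrite !gt_eqF.
move: yg; rewrite [in X in _ <= X]mulrDr E1 E2 => yg.
lra.
Qed.

Lemma denergy_le0 theta s : 0 < theta -> theta <= beta -> s0 <= s ->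
  denergy theta s <= 0.
Proof.
move=> t0 tb s0s; apply: (le_trans (denergy_le t0 s0s)); rewrite oppr_le0.
have sp := ltW (sge0 s0s); have b0 := ltW beta_gt0.
rewrite addr_ge0// !mulr_ge0 ?gap_ge0 ?sqr_ge0 ?exprn_ge0 ?subr_ge0 ?(ltW t0)//.
Qed.

Let half_gt0 : 0 < beta / 2. Proof. by rewrite divr_gt0. Qed.
Let half_le : beta / 2 <= beta. Proof. by have := ltW beta_gt0; lra. Qed.
Let quarter_gt0 : 0 < beta / 4. Proof. by rewrite divr_gt0. Qed.
Let quarter_le : beta / 4 <= beta. Proof. by have := ltW beta_gt0; lra. Qed.

Lemma energy_cvg theta : 0 < theta -> theta <= beta ->
  cvg (energy theta s @[s --> +oo]).
Proof.
move=> t0 tb; apply: (@nonincreasing_cvg_pinfty _ _ s0 0).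
  apply: (@nonincreasing_from _ _ (denergy theta)) => s s0s.
    exact: is_derive_energy.
  exact: denergy_le0.
by move=> s; exact: energy_ge0.
Qed.

Lemma tail_sqr_cvg0 : tail s ^+ 2 @[s --> +oo] --> (0 : R).
Proof. by rewrite -(mulr0 (0 : R)); exact: (cvgM tail_cvg0 tail_cvg0). Qed.

(** Subtracting the energies for two values of [theta] eliminates the distance
    and leaves a multiple of [s^2 gap s], up to a multiple of [tail^2]. *)
Lemma sq_gap_cvg : cvg (s ^+ 2 * gap s @[s --> +oo]).
Proof.
have /cvg_ex[l1 e1] := energy_cvg half_gt0 half_le.
have /cvg_ex[l2 e2] := energy_cvg quarter_gt0 quarter_le.
apply/cvg_ex; exists ((l1 - l2 - (kappa (beta / 2) - kappa (beta / 4)) * 0) * (4 / beta)).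
rewrite (_ : (fun s => _) = fun s =>
  (energy (beta / 2) s - energy (beta / 4) s
   - (kappa (beta / 2) - kappa (beta / 4)) * tail s ^+ 2) * (4 / beta)).
  apply: cvgMr_tmp; apply: cvgB; first exact: cvgB.
  exact: cvgMl_tmp tail_sqr_cvg0.
by apply/funext => s; rewrite /energy; field; rewrite gt_eqF.
Qed.

Lemma shifted_dist_cvg : cvg (`|shifted s - z| ^+ 2 @[s --> +oo]).
Proof.
have /cvg_ex[l1 e1] := energy_cvg half_gt0 half_le.
have /cvg_ex[l2 e2] := sq_gap_cvg.
apply/cvg_ex; exists (l1 - (beta / 2) * l2 - kappa (beta / 2) * 0).
rewrite (_ : (fun s => _) = fun s =>
  energy (beta / 2) s - (beta / 2) * (s ^+ 2 * gap s) - kappa (beta / 2) * tail s ^+ 2).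
  apply: cvgB; last exact: cvgMl_tmp tail_sqr_cvg0.
  by apply: cvgB => //; exact: cvgMl_tmp.
by apply/funext => s; rewrite /energy; ring.
Qed.

Lemma denergy_le_gap s : s0 <= s -> denergy (beta / 2) s <= - (beta * (s * gap s)).
Proof.
move=> s0s; apply: (le_trans (denergy_le half_gt0 s0s)); rewrite lerN2.
rewrite (_ : 2 * (beta - beta / 2) = beta); last by field.
rewrite lerDl; apply: mulr_ge0; first by rewrite !(divr_ge0, mulr_ge0)// ltW.
by rewrite mulr_ge0 ?sqr_ge0// exprn_ge0// ltW// sge0.
Qed.

Lemma denergy_le_gradient s : s0 <= s ->
  denergy (beta / 2) s <= - (beta ^+ 2 / 4 * (s ^+ 3 * `|G s| ^+ 2)).
Proof.
move=> s0s; apply: (le_trans (denergy_le half_gt0 s0s)); rewrite lerN2.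
rewrite (_ : 2 * (beta - beta / 2) = beta); last by field.
rewrite (_ : beta / 2 * beta / 2 = beta ^+ 2 / 4); last by field.
by rewrite lerDr mulr_ge0 ?(ltW beta_gt0)// mulr_ge0 ?gap_ge0// ltW// sge0.
Qed.

Lemma sq_gap_cvg0 : s ^+ 2 * gap s @[s --> +oo] --> 0.
Proof.
have /cvg_ex[l Wl] := sq_gap_cvg.
have l0 : 0 <= l.
  apply: (cvgr_to_ge Wl); near=> s; rewrite mulr_ge0 ?sqr_ge0// gap_ge0//.
have : beta * l <= 0.
  apply: (lyapunov_limit_le0 (g := fun s => beta * (s ^+ 2 * gap s)) s00
     (is_derive_energy (beta / 2)) (m := 0)).
  - by move=> s; exact: energy_ge0.
  - by move=> s; exact: denergy_le0.
  - move=> s s0s; apply: (le_trans (denergy_le_gap s0s)).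
    rewrite le_eqVlt; apply/orP; left; apply/eqP; field.
    by rewrite gt_eqF// sge0.
  exact: cvgMl_tmp.
rewrite pmulr_rle0// => l0'; suff <- : l = 0 by [].
by apply/eqP; rewrite eq_le l0 l0'.
Unshelve. all: by end_near. Qed.

Lemma integral_gap :
  (\int[@lebesgue_measure R]_(s in `[s0, +oo[) (s * gap s)%:E < +oo)%E.
Proof.
apply: (lyapunov_integral_lt_pinfty (m := 0)
  (V := fun s => beta^-1 * energy (beta / 2) s)
  (dV := fun s => beta^-1 * denergy (beta / 2) s)).
- by move=> s s0s; apply: is_derive_mulC; exact: is_derive_energy.
- by move=> s s0s; rewrite mulr_ge0 ?energy_ge0// invr_ge0 ltW.
- by move=> s s0s; rewrite mulr_ge0 ?gap_ge0// ltW// sge0.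
- move=> s s0s; rewrite -(ler_pM2l beta_gt0) mulrA divff ?gt_eqF// mul1r mulrN.
  exact: denergy_le_gap.
- move=> s s0s; apply: (@is_derive_continuous _ R^o _ _ (1 * gap s + s * ip (G s) (v s))).
  exact: is_derive_mul (is_derive_id s 1) (is_derive_gap s0s).
Qed.

Lemma integral_gradient :
  (\int[@lebesgue_measure R]_(s in `[s0, +oo[) (s ^+ 3 * `|G s| ^+ 2)%:E < +oo)%E.
Proof.
have b4 : 0 < beta ^+ 2 / 4 by rewrite divr_gt0// exprn_gt0.
apply: (lyapunov_integral_lt_pinfty (m := 0)
  (V := fun s => (beta ^+ 2 / 4)^-1 * energy (beta / 2) s)
  (dV := fun s => (beta ^+ 2 / 4)^-1 * denergy (beta / 2) s)).
- by move=> s s0s; apply: is_derive_mulC; exact: is_derive_energy.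
- by move=> s s0s; rewrite mulr_ge0 ?energy_ge0// invr_ge0 ltW.
- by move=> s s0s; rewrite mulr_ge0 ?sqr_ge0// exprn_ge0// ltW// sge0.
- move=> s s0s; rewrite -(ler_pM2l b4) mulrA divff ?gt_eqF// mul1r mulrN.
  exact: denergy_le_gradient.
- move=> s s0s; apply: cvgM; first exact: exprn_continuous.
  rewrite expr2; under eq_fun do rewrite expr2.
  by apply: cvgM; apply: cvg_norm; exact: trajectory_gradient_continuous.
Qed.

(** By the first-order equation [s |v|^2] is at most
    [2 beta^2 s^3 |G|^2 + 2 |C|^2 s / weight^2]; the two terms are controlled by
    the decrease of the energy and of [tail^2] respectively. *)
Definition speed_energy s := 8 * energy (beta / 2) s + (alpha - 1) * `|C| ^+ 2 * tail s ^+ 2.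

Definition dspeed_energy s :=
  8 * denergy (beta / 2) s + (alpha - 1) * `|C| ^+ 2 * (2 * tail s * - (weight s)^-1).

Lemma is_derive_speed_energy s : s0 <= s ->
  is_derive s 1 speed_energy (dspeed_energy s).
Proof.
move=> s0s; apply: is_derive_add; first by apply: is_derive_mulC; exact: is_derive_energy.
by apply: is_derive_mulC; apply: is_derive_sqr; apply: is_derive_tail; exact: sge0.
Qed.

Lemma speed_energy_ge0 s : s0 <= s -> 0 <= speed_energy s.
Proof.
move=> s0s; rewrite addr_ge0// mulr_ge0 ?energy_ge0 ?sqr_ge0//.
by rewrite mulr_ge0 ?sqr_ge0// ltW.
Qed.

Lemma dspeed_energy_le s : s0 <= s -> dspeed_energy s <= - (s * `|v s| ^+ 2).
Proof.
move=> s0s; have s_gt0 := sge0 s0s; have m0 := weight_gt0 s_gt0.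
have dG := denergy_le_gradient s0s.
have yg := ip_young ipE 1 (- (s * beta) *: G s) ((weight s)^-1 *: C).
have : `|v s| ^+ 2 <= 2 * ((s * beta) ^+ 2 * `|G s| ^+ 2) + 2 * (`|C| ^+ 2 / weight s ^+ 2).
  have -> : v s = - (s * beta) *: G s + (weight s)^-1 *: C by rewrite vE.
  move: yg; rewrite -!ipE !(ip_lin ip) (ipC _ C (G s)) => yg.
  rewrite -[X in _ <= _ + 2 * X]/(ip C C / weight s ^+ 2).
  have -> : ip C C / weight s ^+ 2 = (weight s)^-1 * ((weight s)^-1 * ip C C).
    by field; rewrite gt_eqF.
  lra.
rewrite -(ler_pM2l s_gt0) => vle.
have -> : dspeed_energy s = 8 * denergy (beta / 2) s - 2 * s * (`|C| ^+ 2 / weight s ^+ 2).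
  by rewrite /dspeed_energy /tail; field; rewrite !gt_eqF.
lra.
Qed.

Lemma dspeed_energy_le0 s : s0 <= s -> dspeed_energy s <= 0.
Proof.
move=> s0s; apply: (le_trans (dspeed_energy_le s0s)).
by rewrite oppr_le0 mulr_ge0 ?sqr_ge0// ltW// sge0.
Qed.

Lemma integral_speed :
  (\int[@lebesgue_measure R]_(s in `[s0, +oo[) (s * `|v s| ^+ 2)%:E < +oo)%E.
Proof.
apply: (lyapunov_integral_lt_pinfty (m := 0) is_derive_speed_energy
  speed_energy_ge0 _ dspeed_energy_le).
- by move=> s s0s; rewrite mulr_ge0 ?sqr_ge0// ltW// sge0.
- move=> s s0s; apply: cvgM; first exact: cvg_id.
  rewrite expr2; under eq_fun do rewrite expr2.
  by apply: cvgM; apply: cvg_norm; exact: vc.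
Qed.

(** * Decay of the velocity and of the gradient *)

(** Monotonicity of the gradient, passed to the limit in difference quotients. *)
Lemma ip_dgradient_speed_ge0 s (G' : H) : s0 <= s -> is_derive s 1 G G' -> 0 <= ip G' (v s).
Proof.
move=> s0s /is_derive1_cvgP dG; have /is_derive1_cvgP dy := yv s0s.
apply: (cvgr_to_ge (cvg_ip ipE dG dy)); near=> h.
rewrite ipZl ipZr mulrA -expr2 mulr_ge0 ?sqr_ge0//.
exact: gradient_monotone.
Unshelve. all: by end_near. Qed.

(** The factor [4 / beta] makes the decrease of the energy compensate the term
    [4 s gap] produced by the derivative of [2 s^2 gap]. *)
Definition total_energy s :=
  s ^+ 2 * (`|v s| * `|v s|) +
  (2 * (s ^+ 2 * gap s) + 4 / beta * energy (beta / 2) s).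

Lemma is_derive_sq_gap s : s0 <= s ->
  is_derive s 1 (fun s => s ^+ 2 * gap s)
    (2 * s * 1 * gap s + s ^+ 2 * ip (G s) (v s)).
Proof.
move=> s0s; apply: is_derive_mul; last exact: is_derive_gap.
by apply: is_derive_sqr; exact: is_derive_id.
Qed.

Lemma sqr_continuous s : {for s, continuous (fun s : R => s ^+ 2)}.
Proof. exact: exprn_continuous. Qed.

Lemma gap_continuous s : s0 <= s -> {for s, continuous gap}.
Proof. by move=> /is_derive_gap; exact: is_derive_continuous. Qed.

Lemma ip_gradient_continuous (u : R -> H) s : s0 <= s -> {for s, continuous u} ->
  {for s, continuous (fun s => ip (G s) (u s))}.
Proof. by move=> s0s cu; exact: (cvg_ip ipE (trajectory_gradient_continuous s0s) cu). Qed.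

Lemma dsq_gap_continuous s : s0 <= s ->
  {for s, continuous (fun s => 2 * s * 1 * gap s + s ^+ 2 * ip (G s) (v s))}.
Proof.
move=> s0s; apply: cvgD; apply: cvgM.
- by apply: cvgMr_tmp; apply: cvgMl_tmp; exact: cvg_id.
- exact: gap_continuous.
- exact: sqr_continuous.
- by apply: ip_gradient_continuous => //; exact: vc.
Qed.

Lemma denergy_continuous theta s : s0 <= s -> {for s, continuous (denergy theta)}.
Proof.
move=> s0s; apply: cvgD; first apply: cvgD.
- apply: cvgMl_tmp; apply: (cvg_ip ipE).
    apply: cvgZ; last exact: trajectory_gradient_continuous.
    by apply: cvgN; apply: cvgMr_tmp; exact: cvg_id.
  apply: cvgB; last exact: cvg_cst.
  by have /is_derive_continuous := is_derive_shifted s0s.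
- by apply: cvgMl_tmp; exact: dsq_gap_continuous.
- have m0 : weight s != 0 by rewrite gt_eqF// weight_gt0// sge0.
  apply: cvgMl_tmp; apply: cvgM.
    apply: cvgMl_tmp.
    by have /is_derive_continuous := is_derive_tail (sge0 s0s).
  apply: cvgN; apply: cvgV => //.
  by have /is_derive_continuous := is_derive_weight (sge0 s0s).
Qed.

Lemma total_energy_ac a b : s0 <= a ->
  abs_continuous a b (total_energy : R -> R^o).
Proof.
move=> s0a; have ge s : a <= s <= b -> s0 <= s.
  by move=> /andP[as_ _]; exact: le_trans as_.
apply: (dominated_abs_continuous (vac b s0a)).
have nv : dominated v a b (fun s => `|v s|).
  apply: (dominated_lipschitz (M := 1)) => // s t _ _ _.
  by rewrite mul1r ler_dist_dist.
have cnv s : a <= s <= b -> {for s, continuous (fun s => `|v s|)}.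
  by move=> /ge s0s; apply: cvg_norm; exact: vc.
apply: dominatedD.
  apply: dominatedM.
  - by move=> s _; exact: sqr_continuous.
  - by move=> s sab; apply: cvgM; exact: cnv.
  - apply: (dominated_derive _ (dg := fun s => 2 * s * 1)) => s _.
      by apply: is_derive_sqr; exact: is_derive_id.
    by apply: cvgMr_tmp; apply: cvgMl_tmp; exact: cvg_id.
  - exact: dominatedM.
apply: (dominated_derive _ (dg := fun s =>
  2 * (2 * s * 1 * gap s + s ^+ 2 * ip (G s) (v s)) + 4 / beta * denergy (beta / 2) s)).
- move=> s /ge s0s; apply: is_derive_add; apply: is_derive_mulC.
    exact: is_derive_sq_gap.
  exact: is_derive_energy.
- move=> s /ge s0s; apply: cvgD; apply: cvgMl_tmp.
    exact: dsq_gap_continuous.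
  exact: denergy_continuous.
Qed.

Lemma total_energy_nonincreasing s t : s0 <= s -> s <= t ->
  total_energy t <= total_energy s.
Proof.
move=> s0s st; apply: (ac_ae_nonincreasing st (total_energy_ac t s0s)).
move: ode; apply: filterS; first exact: (ae_filter_ringOfSetsType lebesgue_measure).
move=> r odeR /andP[sr rt]; have s0r := le_lt_trans s0s sr.
have [v' [G' [dv dG E]]] := odeR s0r.
have r_gt0 := lt_trans s00 s0r; have /ltW s0r' := s0r.
exists (2 * r * 1 * `|v r| ^+ 2 + r ^+ 2 * (2 * ip v' (v r))
   + (2 * (2 * r * 1 * gap r + r ^+ 2 * ip (G r) (v r))
   + 4 / beta * denergy (beta / 2) r)); last first.
  apply: is_derive_add.
    apply: is_derive_mul; first by apply: is_derive_sqr; exact: is_derive_id.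
    have := is_derive_sqnorm ipE 0 dv; rewrite subr0.
    rewrite (_ : (fun s => `|v s - 0| ^+ 2) = fun s => `|v s| * `|v s|)//.
    by apply/funext => x; rewrite subr0.
  by apply: is_derive_add; apply: is_derive_mulC; [exact: is_derive_sq_gap|exact: is_derive_energy].
have Gv := ip_dgradient_speed_ge0 s0r' dG.
have dW := denergy_le_gap s0r'.
have {}dW : 4 / beta * denergy (beta / 2) r <= - 4 * (r * gap r).
  rewrite -mulrA -(ler_pdivlMl _ _ (_ : 0 < 4))// ler_pdivrMl//.
  by apply: (le_trans dW); lra.
have /(congr1 (fun u => r ^+ 2 * ip u (v r))) := E.
rewrite !(ip_lin ip) (ip0l ip) mulr0 ipE => {}E.
have Gv' : 0 <= r ^+ 3 * beta * ip G' (v r).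
  by rewrite !mulr_ge0// ?exprn_ge0 ?ltW.
have av : 0 <= (alpha - 1) * r * `|v r| ^+ 2.
  by rewrite mulr_ge0 ?sqr_ge0// mulr_ge0 ?ltW.
have E' : r ^+ 2 * ip v' (v r) = - (alpha * r * `|v r| ^+ 2)
    - r ^+ 3 * beta * ip G' (v r) - r ^+ 2 * ip (G r) (v r).
  apply/eqP; rewrite -subr_eq0 -E; apply/eqP; rewrite /beta; field.
  by rewrite !gt_eqF.
lra.
Qed.

Lemma sq_speed_cvg0 : s ^+ 2 * `|v s| ^+ 2 @[s --> +oo] --> 0.
Proof.
have b4 : 0 < 4 / beta by rewrite divr_gt0.
have /cvg_ex[l1 e1] : cvg (total_energy s @[s --> +oo]).
  apply: (@nonincreasing_cvg_pinfty _ _ s0 0) total_energy_nonincreasing _.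
  move=> s s0s; apply: addr_ge0; first by rewrite mulr_ge0 ?sqr_ge0// mulr_ge0.
  apply: addr_ge0; first by rewrite mulr_ge0// mulr_ge0 ?sqr_ge0// gap_ge0.
  by rewrite mulr_ge0 ?energy_ge0// ltW.
have /cvg_ex[l2 e2] := energy_cvg half_gt0 half_le.
have vl : s ^+ 2 * `|v s| ^+ 2 @[s --> +oo] --> l1 - 2 * 0 - 4 / beta * l2.
  rewrite (_ : (fun s => _) = fun s =>
    total_energy s - 2 * (s ^+ 2 * gap s) - 4 / beta * energy (beta / 2) s).
    apply: cvgB; last exact: cvgMl_tmp.
    by apply: cvgB => //; apply: cvgMl_tmp; exact: sq_gap_cvg0.
  by apply/funext => s; rewrite /total_energy -expr2; ring.
suff <- : l1 - 2 * 0 - 4 / beta * l2 = 0 by [].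
apply/eqP; rewrite eq_le; apply/andP; split.
  apply: (lyapunov_limit_le0 s00 is_derive_speed_energy speed_energy_ge0
    dspeed_energy_le0 _ vl).
  move=> s s0s; apply: (le_trans (dspeed_energy_le s0s)).
  rewrite le_eqVlt; apply/orP; left; apply/eqP; field.
  by rewrite gt_eqF// sge0.
by apply: (cvgr_to_ge vl); near=> s; rewrite mulr_ge0 ?sqr_ge0.
Unshelve. all: by end_near. Qed.

Lemma speed_cvg0 : s * `|v s| @[s --> +oo] --> 0.
Proof.
apply/cvgr0Pnorm_le => e e0.
have e2 : 0 < e ^+ 2 by rewrite exprn_gt0.
have /cvgr0Pnorm_le /(_ _ e2) := sq_speed_cvg0.
apply: filterS => s; rewrite -exprMn normrX.
by rewrite ler_pXn2r// nnegrE// ltW.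
Qed.

Lemma sq_gradient_cvg0 : s ^+ 2 * `|G s| @[s --> +oo] --> 0.
Proof.
have lim : (alpha + 1) * (s * `|v s| + (alpha - 1) * tail s * `|C|) @[s --> +oo] --> 0.
  rewrite -[X in _ --> X](mulr0 (alpha + 1)); apply: cvgMl_tmp.
  rewrite -[X in _ --> X]addr0; apply: cvgD; first exact: speed_cvg0.
  rewrite -[X in _ --> X](mul0r `|C|); apply: cvgMr_tmp.
  rewrite -[X in _ --> X](mulr0 (alpha - 1)); apply: cvgMl_tmp; exact: tail_cvg0.
apply: (@squeeze_cvgr _ _ _ _ (fun=> 0) _ _ _ 0 (cvg_cst _) lim).
near=> s; rewrite mulr_ge0 ?sqr_ge0//=.
have s0s : s0 <= s by near: s; apply: nbhs_pinfty_ge; exact: num_real.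
have s_gt0 := sge0 s0s; have m0 := weight_gt0 s_gt0.
have vG : (s / (alpha + 1)) *: G s = (weight s)^-1 *: C - v s.
  by rewrite vE// opprD scaleNr opprK addrCA subrr addr0.
have : `|(s / (alpha + 1)) *: G s| <= (weight s)^-1 * `|C| + `|v s|.
  rewrite vG (le_trans (ler_normB _ _))// normrZ ger0_norm// invr_ge0 ltW//.
rewrite normrZ ger0_norm; last by rewrite divr_ge0// ltW.
have p0 : 0 < (alpha + 1) * s by rewrite mulr_gt0.
rewrite -(ler_pM2l p0).
have -> : (alpha + 1) * s * (s / (alpha + 1) * `|G s|) = s ^+ 2 * `|G s|.
  by field; rewrite gt_eqF.
move=> /le_trans; apply; rewrite le_eqVlt; apply/orP; left; apply/eqP.
by rewrite /tail; field; rewrite !gt_eqF.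
Unshelve. all: by end_near. Qed.

End minimizer.

(** * Weak convergence *)

Lemma gap_cvg0 z : argmin f z -> gap z s @[s --> +oo] --> 0.
Proof.
move=> fz; have lim : (s0 ^+ 2)^-1 * (s ^+ 2 * gap z s) @[s --> +oo] --> 0.
  by rewrite -[X in _ --> X](mulr0 (s0 ^+ 2)^-1); apply: cvgMl_tmp; exact: sq_gap_cvg0.
apply: (@squeeze_cvgr _ _ _ _ (fun=> 0) _ _ _ 0 (cvg_cst _) lim).
near=> s; rewrite gap_ge0//=.
have s0s : s0 <= s by near: s; apply: nbhs_pinfty_ge; exact: num_real.
rewrite ler_pdivlMl ?exprn_gt0// ler_wpM2r ?gap_ge0//.
by rewrite ler_pXn2r// nnegrE ltW// sge0.
Unshelve. all: by end_near. Qed.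

(** In the gradient inequality at [p], the inner product tends to 0 along the
    ultrafilter while [f (y s)] tends to the minimum. *)
Lemma weak_cluster_argmin z p (U : set_system R) : argmin f z ->
  UltraFilter U -> +oo%R `<=` U ->
  (forall u, ip (shifted s) u @[s --> U] --> ip p u) -> argmin f p.
Proof.
move=> fz UU FU zp x; apply: le_trans (fz x).
pose g := gradient ip f p.
have toU (h : R -> R) (l : R) : h s @[s --> +oo] --> l -> h s @[s --> U] --> l.
  by move=> hl; apply: cvg_trans hl => A; exact: FU.
(* The left-hand side is [f (y s) - ip (y s - p) g], written with the quantities
   whose limits are known. *)
have lim : gap z s + f z + tail s * ip g C - ip (shifted s) g + ip p g @[s --> U] -->
    0 + f z + 0 * ip g C - ip p g + ip p g.
  apply: cvgD; last exact: cvg_cst.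
  apply: cvgB; last exact: zp.
  apply: cvgD; last by apply: cvgMr_tmp; apply: toU; exact: tail_cvg0.
  by apply: cvgD; [apply: toU; exact: gap_cvg0|exact: cvg_cst].
have -> : f z = 0 + f z + 0 * ip g C - ip p g + ip p g.
  by rewrite mul0r addr0 subrK add0r.
apply: (cvgr_to_ge lim); near=> s.
have := convex_gradient_le ipE fdiff fconv p (y s).
rewrite -/g /gap /shifted !(ip_lin ip) (ipC ip g (y s)) (ipC ip g p) (ipC ip g C).
lra.
Unshelve. all: by end_near. Qed.

Lemma trajectory_weak_cvg : argmin f !=set0 ->
  exists2 l, argmin f l & weak_cvg (y s @[s --> +oo]) l.
Proof.
move=> f0; have [z fz] := f0.
have [||p fp zp] := @opial R H ip ipE _ +oo%R _ shifted _ f0.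
- by move=> z' fz'; exact: shifted_dist_cvg.
- by move=> U p UU FU; exact: weak_cluster_argmin fz UU FU.
exists p => // phi /(riesz_linear ipE)[g phiE].
have lim : ip (shifted s) g - tail s * ip C g @[s --> +oo] --> ip p g - 0 * ip C g.
  by apply: cvgB; [exact: zp|apply: cvgMr_tmp; exact: tail_cvg0].
have phiyE : (fun s => ip (shifted s) g - tail s * ip C g) = phi \o y.
  by apply/funext => s; rewrite /= phiE (ipC ip g) ipDl ipZl addrK.
have -> : phi p = ip p g - 0 * ip C g by rewrite phiE (ipC ip) mul0r subr0.
by move: lim; rewrite phiyE.
Qed.

End shifted_flow.

End trajectory.

(** * Extension to the left of the initial time, and conclusion *)

Section extension.
Context (R : realType) (H : completeNormedModType R) (s0 : R).
Let I : set R := `[s0, +oo[%classic.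

Lemma derivable_withinP (u : R -> H) s : derivable_within I u s ->
  forall e, 0 < e -> exists2 r, 0 < r & forall t, s0 <= t -> `|t - s| < r ->
    `|u t - u s - (t - s) *: derive_within I u s| <= e * `|t - s|.
Proof.
move=> du e e0.
have /cvgrPdist_le/(_ _ e0) [r /= r0 ur] :
  (fun t : R => (t - s)^-1 *: (u t - u s)) @ within I s^' --> derive_within I u s by [].
exists r => // t st tsr; have [->|ts] := eqVneq t s.
  by rewrite !subrr scale0r subrr !normr0 mulr0.
have ts0 : t - s != 0 by rewrite subr_eq0.
have -> : u t - u s - (t - s) *: derive_within I u s =
    - ((t - s) *: (derive_within I u s - (t - s)^-1 *: (u t - u s))).
  by rewrite scalerBr scalerA divff// scale1r opprB.
rewrite normrN normrZ mulrC ler_wpM2r//; apply: ur => //=.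
  by rewrite distrC.
by rewrite /I/= in_itv/= st.
Qed.

Lemma derivable_within_interior (u : R -> H) s : s0 < s ->
  derivable_within I u s -> is_derive s 1 u (derive_within I u s).
Proof.
move=> s0s du; apply/is_derive1P => e e0.
have [r r0 ur] := derivable_withinP du e0.
exists (Num.min r (s - s0)); first by rewrite lt_min r0 subr_gt0.
move=> t; rewrite lt_min => /andP[tr tss]; apply: ur => //.
by move: tss; rewrite ltr_norml => /andP[? _]; lra.
Qed.

(** One-sided derivatives at the initial time become two-sided ones, so that the
    differential calculus at [s0] is the same as elsewhere. *)
Definition affine_extension (u : R -> H) t : H :=
  if s0 <= t then u t else u s0 + (t - s0) *: derive_within I u s0.

Lemma affine_extensionE u t : s0 <= t -> affine_extension u t = u t.
Proof. by rewrite /affine_extension => ->. Qed.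

Lemma is_derive_affine_extension (u : R -> H) s : s0 <= s ->
  derivable_within I u s ->
  is_derive s 1 (affine_extension u) (derive_within I u s).
Proof.
rewrite le_eqVlt => /predU1P[<-|s0s] du.
  apply/is_derive1P => e e0; have [r r0 ur] := derivable_withinP du e0.
  exists r => // t tr; rewrite (affine_extensionE _ (lexx s0)) /affine_extension.
  case: ifPn => [s0t|_]; first exact: ur.
  by rewrite addrAC addrK subrr normr0 mulr_ge0// ltW.
apply: (near_eq_is_derive (f := u)); last exact: derivable_within_interior.
near=> t; rewrite affine_extensionE//; apply/ltW; near: t.
exact: lt_nbhsr.
Unshelve. all: by end_near. Qed.

(** Precomposition with [Num.max s0] is the corresponding extension of the
    velocity. *)
Lemma clamp_continuous (u : R -> H) s : {within I, continuous u} -> s0 <= s ->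
  {for s, continuous (fun t => u (Num.max s0 t))}.
Proof.
move=> /subspace_continuousP cu s0s.
have /cu : I s by rewrite /I/= in_itv/= s0s.
move=> /cvgrPdist_le us; apply/cvgrPdist_le => e e0.
have [r /= r0 ur] := us e e0.
exists r => // t /= tr; rewrite (max_r s0s); apply: ur => /=; last first.
  by rewrite /I/= in_itv/= le_max lexx.
apply: le_lt_trans tr; have [s0t|ts0] := leP s0 t; first by [].
by rewrite !ger0_norm ?subr_ge0//; lra.
Qed.

End extension.

Lemma littleo_pinfty (R : realType) (n : nat) (g : R -> R) :
  s ^+ n * g s @[s --> +oo] --> 0 ->
  (g : R -> R^o) =o_ (pinfty_nbhs R) (fun s : R => s ^- n : R^o).
Proof.
move=> /cvgr0Pnorm_le g0; apply/eqoP => e e0; have := g0 e e0.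
move=> ge; near=> s.
have s0 : 0 < s by near: s; apply: nbhs_pinfty_gt; exact: num_real.
have : `|s ^+ n * g s| <= e by near: s.
rewrite normrM normrV ?unitfE ?expf_neq0 ?gt_eqF//.
by rewrite ler_pdivlMr ?normr_gt0 ?expf_neq0 ?gt_eqF// mulrC.
Unshelve. all: by end_near. Qed.

Lemma inf_range_argmin (R : realType) (H : completeNormedModType R) (f : H -> R) z :
  argmin f z -> inf (range f) = f z.
Proof.
move=> fz; apply/eqP; rewrite eq_le; apply/andP; split.
  by apply: ge_inf; [exists (f z) => _ [x _ <-]; exact: fz|exists z].
by apply: lb_le_inf; [exists (f z), z|move=> _ [x _ <-]; exact: fz].
Qed.

Theorem theorem4 (R : realType) (H : completeNormedModType R)
    (ip : {dot H for idfun}) (f : H -> R) (s0 alpha : R) (y : R -> H) :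
  induces_norm ip ->
  convex_function (E := H) setT f ->
  class_C1 f ->
  argmin f !=set0 ->
  (forall B : set H, bounded_set B -> [lipschitz gradient ip f x | x in B]) ->
  0 < s0 ->
  1 < alpha ->
  solution_trajectory ip f alpha s0 y ->
  let dy := derive_within `[s0, +oo[%classic y in
  [/\ (\int[@lebesgue_measure R]_(s in `[s0, +oo[)
         (s * `|dy s| ^+ 2)%:E < +oo)%E,
      (\int[@lebesgue_measure R]_(s in `[s0, +oo[)
         (s * (f (y s) - inf (range f)))%:E < +oo)%E,
      (\int[@lebesgue_measure R]_(s in `[s0, +oo[)
         (s ^+ 3 * `|gradient ip f (y s)| ^+ 2)%:E < +oo)%E,
      (fun s : R => f (y s) - inf (range f) : R^o)
        =o_ (pinfty_nbhs R) (fun s : R => s ^- 2 : R^o) &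
      exists2 l : H, argmin f l & weak_cvg (y s @[s --> pinfty_nbhs R]) l] /\
  (2 < alpha ->
     (fun s : R => `|dy s| : R^o) =o_ (pinfty_nbhs R) (fun s : R => s^-1 : R^o) /\
     (fun s : R => `|gradient ip f (y s)| : R^o)
       =o_ (pinfty_nbhs R) (fun s : R => s ^- 2 : R^o)).
Proof.
move=> ipE fconv [fdiff _] f0 flip s00 alpha1 [[dyI cdy] acdy odey] dy.
have [z fz] := f0.
pose v t := dy (Num.max s0 t).
pose Y := affine_extension s0 y.
have YE t : s0 <= t -> Y t = y t by exact: affine_extensionE.
have vdy t : s0 <= t -> v t = dy t by move=> s0t; rewrite /v max_r.
have yv s : s0 <= s -> is_derive s 1 Y (v s).
  move=> s0s; rewrite vdy//; apply: is_derive_affine_extension => //.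
  by apply: dyI; rewrite /= in_itv/= s0s.
have vc s : s0 <= s -> {for s, continuous v} by exact: clamp_continuous.
have vac a b : s0 <= a -> abs_continuous a b v.
  move=> s0a; apply: (abs_continuous_dominated (M := 1) (acdy a b s0a)).
  move=> t r at_ tr rb; have s0t := le_trans s0a at_.
  by rewrite !vdy ?(le_trans s0t)// mul1r lerDl subr_ge0.
have nearE (K : completeNormedModType R) (g h : R -> K) s (d : K) : s0 < s ->
    (forall t, s0 <= t -> g t = h t) -> is_derive s 1 g d -> is_derive s 1 h d.
  move=> s0s gh; apply: near_eq_is_derive; near=> t; apply: gh; apply/ltW.
  by near: t; exact: lt_nbhsr.
have ode : {ae (@lebesgue_measure R), forall s, s0 < s ->
    exists v' G', [/\ is_derive s 1 v v',
      is_derive s 1 (fun t => gradient ip f (Y t)) G' &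
      v' + (alpha / s) *: v s + (s / (alpha + 1)) *: G' + gradient ip f (Y s) = 0]}.
  move: odey; apply: filterS; first exact: (ae_filter_ringOfSetsType lebesgue_measure).
  move=> s odes s0s; have s0s' := ltW s0s; have [ddy dgy E] := odes s0s'.
  exists (derive_within `[s0, +oo[ dy s),
    (derive_within `[s0, +oo[ (gradient ip f \o y) s); split.
  - apply: (nearE _ dy _ _ _ s0s); first by move=> t /vdy.
    exact: derivable_within_interior s0s ddy.
  - apply: (nearE _ (gradient ip f \o y) _ _ _ s0s); first by move=> t /YE/= ->.
    exact: derivable_within_interior s0s dgy.
  - by rewrite (vdy _ s0s') (YE _ s0s').
have [C vE] := ode_first_order ipE flip s00 alpha1 yv vc vac ode.
rewrite (inf_range_argmin fz).
have toI (g h : R -> R) : (forall s, s0 <= s -> g s = h s) ->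
    (\int[@lebesgue_measure R]_(s in `[s0, +oo[) (g s)%:E < +oo)%E ->
    (\int[@lebesgue_measure R]_(s in `[s0, +oo[) (h s)%:E < +oo)%E.
  move=> gh; have -> // : (\int[@lebesgue_measure R]_(s in `[s0, +oo[) (h s)%:E =
    \int[@lebesgue_measure R]_(s in `[s0, +oo[) (g s)%:E)%E.
  apply: eq_integral => s /set_mem/=; rewrite in_itv/= andbT => s0s.
  by rewrite (gh _ s0s).
have toO (g h : R -> R) (l : R) : (forall s, s0 <= s -> g s = h s) ->
    g s @[s --> +oo] --> l -> h s @[s --> +oo] --> l.
  move=> gh; apply: cvg_trans; apply: near_eq_cvg; near=> s; apply: gh.
  by near: s; apply: nbhs_pinfty_ge; exact: num_real.
split; last move=> _; split.
- apply: toI (integral_speed ipE fdiff fconv s00 alpha1 yv vc vE fz).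
  by move=> s s0s; rewrite vdy.
- apply: toI (integral_gap ipE fdiff fconv s00 alpha1 yv vE fz).
  by move=> s s0s; rewrite /gap YE.
- apply: toI (integral_gradient ipE fdiff fconv flip s00 alpha1 yv vE fz).
  by move=> s s0s; rewrite YE.
- apply: littleo_pinfty; apply: toO (sq_gap_cvg0 ipE fdiff fconv s00 alpha1 yv vE fz).
  by move=> s s0s; rewrite /gap YE.
- have [l fl Yl] := trajectory_weak_cvg ipE fdiff fconv s00 alpha1 yv vE f0.
  exists l => // phi cphi; apply: (toO (phi \o Y) _ _ _ (Yl phi cphi)).
  by move=> s /YE/= ->.
- apply: (@littleo_pinfty _ 1).
  apply: toO (speed_cvg0 ipE fdiff fconv flip s00 alpha1 yv vc vac ode vE fz).
  by move=> s s0s; rewrite vdy// expr1.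
- apply: littleo_pinfty.
  apply: toO (sq_gradient_cvg0 ipE fdiff fconv flip s00 alpha1 yv vc vac ode vE fz).
  by move=> s s0s; rewrite YE.
Unshelve. all: by end_near. Qed.
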